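(* Let $d\ge 1$ be an integer and let $\mu,\nu\in\mathcal{P}_2(\mathbb{R}^d)$. Then $$\frac14\, W_2^2(\mu,\nu)\ \le\ Z_2(\mu,\nu),$$ and the constant $\frac14$ cannot be improved; that is, for every $d\ge1$ and every $c>\frac14$ there exist $\mu,\nu\in\mathcal{P}_2(\mathbb{R}^d)$ with $Z_2(\mu,\nu)< c\,W_2^2(\mu,\nu)$. Moreover, for $\mu,\nu\in\mathcal{P}_2(\mathbb{R}^d)$, the equality $\frac14 W_2^2(\mu,\nu)=Z_2(\mu,\nu)$ holds if and only if $\mu=\nu$.
   Context: $\mathcal{P}_2(\mathbb{R}^d)$ is the set of Borel probability measures $\mu$ on $\mathbb{R}^d$ with $\int|x|^2\,\mu(dx)<+\infty$, where $|\cdot|$ is the Euclidean norm. $\Gamma(\mu,\nu)$ is the set of Borel probability measures on $\mathbb{R}^d\times\mathbb{R}^d$ with first marginal $\mu$ and second marginal $\nu$. The Wasserstein distance is $$W_2(\mu,\nu)=\Big(\inf\Big\{\iint|x-y|^2\,\gamma(dxdy)\,:\,\gamma\in\Gamma(\mu,\nu)\Big\}\Big)^{1/2}.$$ $C^{1,1}(\mathbb{R}^d)$ is the space of continuously differentiable functions $u:\mathbb{R}^d\to\mathbb{R}$ whose gradient is Lipschitz, and $\mathrm{lip}(\nabla u)$ denotes the (Euclidean) Lipschitz constant of $\nabla u$. The second-order Zolotarev distance is $$Z_2(\mu,\nu)=\sup\Big\{\int u\,d(\nu-\mu)\,:\,u\in C^{1,1}(\mathbb{R}^d),\ \mathrm{lip}(\nabla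 u)\le1\Big\}\in[0,+\infty],$$ which equals $+\infty$ when the barycentres of $\mu$ and $\nu$ differ. *)

(* Defs.v *)
From mathcomp Require Import all_boot all_order all_algebra.
From mathcomp Require Import all_classical all_reals all_analysis.

Set Implicit Arguments.
Unset Strict Implicit.
Unset Printing Implicit Defensive.

Import Order.TTheory GRing.Theory Num.Theory.
Import numFieldNormedType.Exports.

Local Open Scope classical_set_scope.
Local Open Scope ring_scope.

(* Vectors of R^d are row vectors ['rV[R]_d].  The norm [`|x|] of the library
   on ['rV[R]_d] is the sup norm; it is used only through the topology and the
   notion of differentiability, which do not depend on the norm. *)
Definition enorm (R : realType) (d : nat) (x : 'rV[R]_d) : R :=
  Num.sqrt (\sum_(i < d) x 0 i ^+ 2).

(* The carrier is convertible to ['rV[R]_d].  The library sigma-algebra on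
   [borelRd R d * borelRd R d] is the product one, which is the Borel
   sigma-algebra of the product since R^d is second countable. *)
Definition borelRd (R : realType) (d : nat) :
    measurableType (@open 'rV[R]_d).-sigma :=
  g_sigma_algebraType (@open 'rV[R]_d).

Section wasserstein.
Context (R : realType) (d : nat).
Implicit Types mu nu : probability (borelRd R d) R.
Local Open Scope ereal_scope.

Definition P2 mu : Prop :=
  \int[mu]_x ((enorm (x : 'rV[R]_d) ^+ 2)%R)%:E < +oo.

(* Library measures are functions on all sets, but are only constrained on the
   measurable ones; equality of measures is thus tested on measurable sets. *)
Definition meas_eq mu nu : Prop :=
  forall A, measurable A -> mu A = nu A.

Definition couplings mu nu :
    set (probability (borelRd R d * borelRd R d)%type R) :=
  [set gamma | forall A : set (borelRd R d), measurable A ->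
     pushforward gamma fst A = mu A /\ pushforward gamma snd A = nu A].

Definition transport_cost
    (gamma : probability (borelRd R d * borelRd R d)%type R) : \bar R :=
  \int[gamma]_z ((enorm ((z.1 : 'rV[R]_d) - (z.2 : 'rV[R]_d)) ^+ 2)%R)%:E.

Definition W2 mu nu : \bar R :=
  sqrte (ereal_inf [set transport_cost gamma | gamma in couplings mu nu]).

End wasserstein.

Section zolotarev.
Context (R : realType) (d : nat).
Implicit Types (mu nu : probability (borelRd R d) R) (u : 'rV[R]_d -> R).

Definition grad u (x : 'rV[R]_d) : 'rV[R]_d :=
  \row_(i < d) 'D_(delta_mx 0 i) u x.

(* Euclidean Lipschitz constant, equal to +oo if the map is not Lipschitz. *)
Definition lip (f : 'rV[R]_d -> 'rV[R]_d) : \bar R :=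
  ereal_inf [set L%:E | L in
    [set L : R | 0 <= L /\
      forall x y, enorm (f x - f y) <= L * enorm (x - y)]].

Definition C11 u : Prop :=
  [/\ forall x, differentiable u x,
      continuous (grad u) &
      (lip (grad u) < +oo)%E].

(* For mu, nu in P2 and u in C11 both integrals below are finite, since u has
   at most quadratic growth. *)
Definition Z2 mu nu : \bar R :=
  ereal_sup [set (\int[nu]_x (u x)%:E - \int[mu]_x (u x)%:E)%E
            | u in [set u | C11 u /\ (lip (grad u) <= 1%:E)%E]].

End zolotarev.

(* Main.v *)
Require Import Defs.
From HB Require Import structures.
From mathcomp Require Import all_boot all_order all_algebra.
From mathcomp Require Import all_classical all_reals all_analysis.
From mathcomp Require Import measurable_realfun ring lra.

Set Implicit Arguments.
Unset Strict Implicit.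
Unset Printing Implicit Defensive.

Import Order.TTheory GRing.Theory Num.Theory.
Import numFieldNormedType.Exports.

Local Open Scope classical_set_scope.
Local Open Scope ring_scope.

(** Why the theorem holds.

    Let [c(x,y) = |x - y|^2 / 4].  By Kantorovich duality [W_2^2 / 4] is the
    supremum of [int psi d nu + int phi d mu] over the pairs of potentials with
    [phi(x) + psi(y) <= c(x,y)].  Put [Phi(x) = sup_y (psi(y) - c(x,y))], so that
    [Phi <= - phi]; the function [Phi + |.|^2/4] is convex.  Its Moreau envelope
    [u(z) = min_x (Phi(x) + |x - z|^2/2)] has its Hessian between [-1] and [1],
    because a lower bound [-1/2] for the Hessian of [Phi] becomes
    [-(1/2) / (1 - 1/2) = -1], and it satisfies [psi <= u <= Phi <= - phi].
    Hence [int u d(nu - mu) >= int psi d nu + int phi d mu], which is the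
    inequality.  Here [quad_tangent u g] states the Hessian bound without
    derivatives: [u] differs from each of its tangents, of slope [g], by at most
    half of the squared distance.  This is equivalent to membership in [C^{1,1}]
    with [grad u = g] of Lipschitz constant at most one
    ([quad_tangent_C11], [C11_quad_tangent]), and the envelope is
    [quad_tangent_interpolation].

    General duality is avoided by cutting [mu] and [nu] into finitely many
    pieces of small dispersion ([small_dispersion_mixture]).  If [x_i] and [y_j]
    are the barycentres of the pieces, the linear terms integrate to zero, so
    that replacing the measures by atoms at the barycentres changes
    [int u d(nu - mu)] by at most half of the total dispersion
    ([quad_tangent_mean_ge], [quad_tangent_mean_le]), and a plan between the atoms
    lifts to a coupling of [mu] and [nu] whose cost is larger by exactly the
    total dispersion ([W2_sqr_le_gluing]).  Between atoms, duality is needed up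
    to a small error only, and maximising a quadratically penalised dual
    functional gives it ([transport_duality]).

    The case of equality.  The envelope leaves a margin: at the atoms both
    inequalities [psi <= u] and [u <= - phi] gain [|grad u|^2 / 4].  The margin
    pays for replacing [u] by its dilation [l^-2 u(l .)], which is again
    admissible, up to an error of second order in [1 - l]; this gives
    [W_2^2 / 4 <= l^2 Z_2 + (3/2) (1 - l)^2 M] for [0 < l <= 1], where [M] is the
    sum of the second moments ([dilated_test_function]).  If [W_2^2 / 4 = Z_2],
    dividing by [1 - l] and letting [l] tend to one gives [W_2 = 0], hence
    [mu = nu].

    Optimality of the constant.  A function on the line whose second derivative
    alternates between [1] and [-1] oscillates by [1/4] between consecutive
    integers, so measures carried by the even and by the odd integers are at
    distance at least one while they can be told apart only by about [1/4] per
    unit of mass.  The bound [1/4] for one edge of the chain of integers comes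
    with a slope term, and these terms have to cancel almost entirely in the sum;
    they do when the edge starts at [a + b], with [a] and [b] uniform on an
    interval of integers ([alternating_double_sum], [chain_measures]). *)

(** * Euclidean inner product *)

(** Pointwise forms of the continuity rules, which chain without mentioning
    points. *)
Section pointwise_continuity.
Context {R : realType} {T : topologicalType}.
Implicit Types f g : T -> R.

Lemma cts_cst (c : R) : continuous (fun _ : T => c).
Proof. by move=> t; exact: cvg_cst. Qed.

Lemma ctsD f g : continuous f -> continuous g -> continuous (fun t => f t + g t).
Proof. by move=> cf cg t; exact: (continuousD (cf t) (cg t)). Qed.

Lemma ctsB f g : continuous f -> continuous g -> continuous (fun t => f t - g t).
Proof. by move=> cf cg t; exact: (continuousB (cf t) (cg t)). Qed.

Lemma ctsM f g : continuous f -> continuous g -> continuous (fun t => f t * g t).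
Proof. by move=> cf cg t; exact: (continuousM (cf t) (cg t)). Qed.

Lemma cts_max f g : continuous f -> continuous g ->
  continuous (fun t => Order.max (f t) (g t)).
Proof. by move=> cf cg t; exact: (@continuous_max R _ f g t (cf t) (cg t)). Qed.

Lemma cts_sum (I : Type) (r : seq I) (F : I -> T -> R) :
  (forall i, continuous (F i)) -> continuous (fun t => \sum_(i <- r) F i t).
Proof. by move=> cF; apply: continuous_big => [|i _]; [exact: add_continuous|exact: cF]. Qed.

End pointwise_continuity.


Section inner_product.
Context {R : realType} {d : nat}.
Implicit Types (x y z v w : 'rV[R]_d) (a : R).

Definition dot x y : R := \sum_(i < d) x 0 i * y 0 i.

Lemma dotC x y : dot x y = dot y x.
Proof. by apply: eq_bigr => i _; rewrite mulrC. Qed.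

Lemma dotDl x y z : dot (x + y) z = dot x z + dot y z.
Proof. by rewrite /dot -big_split; apply: eq_bigr => i _; rewrite mxE mulrDl. Qed.

Lemma dotZl a x y : dot (a *: x) y = a * dot x y.
Proof. by rewrite /dot mulr_sumr; apply: eq_bigr => i _; rewrite mxE mulrA. Qed.

Lemma dotNl x y : dot (- x) y = - dot x y.
Proof. by rewrite -scaleN1r dotZl mulN1r. Qed.

Lemma dotDr x y z : dot x (y + z) = dot x y + dot x z.
Proof. by rewrite dotC dotDl !(dotC x). Qed.

Lemma dotZr a x y : dot x (a *: y) = a * dot x y.
Proof. by rewrite dotC dotZl (dotC x). Qed.

Lemma dotNr x y : dot x (- y) = - dot x y.
Proof. by rewrite dotC dotNl (dotC x). Qed.

Definition dotE := (dotDl, dotDr, dotNl, dotNr, dotZl, dotZr).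

Lemma dot0l x : dot 0 x = 0.
Proof. by rewrite -(scale0r 0) dotZl mul0r. Qed.

Lemma dot0r x : dot x 0 = 0.
Proof. by rewrite dotC dot0l. Qed.

Lemma dot_ge0 x : 0 <= dot x x.
Proof. by apply: sumr_ge0 => i _; rewrite -expr2 sqr_ge0. Qed.

Lemma dot_delta v i : dot v (delta_mx 0 i) = v 0 i.
Proof.
rewrite /dot (bigD1 i)//= big1 ?addr0 ?mxE ?eqxx ?mulr1// => j ji.
by rewrite mxE (negbTE ji) andbF mulr0.
Qed.

Lemma coord_sqr_le_dot x i : x 0 i ^+ 2 <= dot x x.
Proof.
rewrite /dot (bigD1 i)//= -expr2 lerDl; apply: sumr_ge0 => j _.
by rewrite -expr2 sqr_ge0.
Qed.

(** The weight [k] is left free, since the quarters in the final estimate come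
    from particular choices of it. *)
Lemma dot_young (k : R) x y : 0 < k ->
  dot x y <= k * dot x x + (4 * k)^-1 * dot y y.
Proof.
move=> k0; have kN : k != 0 by rewrite gt_eqF.
have := dot_ge0 (x - (2 * k)^-1 *: y); rewrite !dotE (dotC y x) => h.
have {}h := mulr_ge0 (ltW k0) h.
rewrite -subr_ge0; apply: le_trans h _; rewrite le_eqVlt; apply/orP; left.
by apply/eqP; field.
Qed.

Lemma dot_cauchy x y : dot x y ^+ 2 <= dot x x * dot y y.
Proof.
have [y0|y0] := eqVneq (dot y y) 0.
  suff -> : y = 0 by rewrite !dot0r expr0n mulr0.
  by apply/rowP => i; have := coord_sqr_le_dot y i; rewrite y0 mxE => yi; apply/eqP; rewrite -sqrf_eq0 eq_le yi sqr_ge0.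
have yp : 0 < dot y y by rewrite lt_neqAle eq_sym y0 dot_ge0.
have := dot_ge0 (dot y y *: x - dot x y *: y); rewrite !dotE (dotC y x) => h.
suff : 0 <= dot y y * (dot x x * dot y y - dot x y ^+ 2).
  by rewrite pmulr_rge0// subr_ge0.
by apply: le_trans h _; rewrite le_eqVlt; apply/orP; left; apply/eqP; ring.
Qed.

Lemma enorm_sqr x : enorm x ^+ 2 = dot x x.
Proof.
rewrite /enorm sqr_sqrtr; first by apply: eq_bigr => i _; rewrite expr2.
by apply: sumr_ge0 => i _; exact: sqr_ge0.
Qed.

Lemma enorm_ge0 x : 0 <= enorm x. Proof. exact: sqrtr_ge0. Qed.

Lemma dot_le_enorm x y : dot x y <= enorm x * enorm y.
Proof.
apply: le_trans (ler_norm _) _.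
rewrite -ler_sqr ?nnegrE ?mulr_ge0 ?enorm_ge0//.
by rewrite exprMn !enorm_sqr real_normK ?num_real ?dot_cauchy.
Qed.

Lemma enorm_le x y : (enorm x <= enorm y) = (dot x x <= dot y y).
Proof. by rewrite -!enorm_sqr ler_pXn2r// nnegrE enorm_ge0. Qed.

Lemma continuous_dot (T : topologicalType) (f g : T -> 'rV[R]_d) :
  continuous f -> continuous g -> continuous (fun t => dot (f t) (g t)).
Proof.
have cc (h : T -> 'rV[R]_d) i : continuous h -> continuous (fun t => h t 0 i).
  by move=> ch t; exact: (continuous_comp (ch t) (@coord_continuous _ _ _ 0 i (h t))).
move=> cf cg; apply: cts_sum => i.
by apply: ctsM; exact: cc.
Qed.

Lemma continuous_dotr z : continuous (dot z).
Proof.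
have cz : continuous (fun _ : 'rV[R]_d => z) by exact: cst_continuous.
have ci : continuous (fun x : 'rV[R]_d => x) by move=> ?; exact: cvg_id.
exact: (continuous_dot cz ci).
Qed.

Lemma continuous_dotl z : continuous (dot^~ z).
Proof. by under eq_fun do rewrite dotC; exact: continuous_dotr. Qed.

Lemma continuous_sqnorm : continuous (fun x => dot x x).
Proof.
have ci : continuous (fun x : 'rV[R]_d => x) by move=> ?; exact: cvg_id.
exact: (continuous_dot ci ci).
Qed.

End inner_product.

(** * Functions within a quadratic of their tangents *)

Section quadratic_tangent.
Context {R : realType} {d : nat}.
Implicit Types (u : 'rV[R]_d -> R) (g : 'rV[R]_d -> 'rV[R]_d).

(** A first-order form of [C^{1,1}] with constant one: testing it requires no
    differentiation, and the condition passes to dilations and integrals. *)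
Definition quad_tangent u g := forall x y,
  `|u y - u x - dot (g x) (y - x)| <= 2^-1 * dot (y - x) (y - x).

Lemma quad_tangent_le u g x y : quad_tangent u g ->
  u y <= u x + dot (g x) (y - x) + 2^-1 * dot (y - x) (y - x).
Proof. by move=> /(_ x y); rewrite ler_norml => /andP[_]; lra. Qed.

Lemma quad_tangent_ge u g x y : quad_tangent u g ->
  u x + dot (g x) (y - x) - 2^-1 * dot (y - x) (y - x) <= u y.
Proof. by move=> /(_ x y); rewrite ler_norml => /andP[+ _]; lra. Qed.

(** The upper bound from [x] and the lower bound from [y] are compared at the
    midpoint, which turns the constant [1/2] into [1/4]. *)
Lemma quad_tangent_midpoint u g x y : quad_tangent u g ->
  u y - u x <= 2^-1 * (dot (g x) (y - x) + dot (g y) (y - x))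
               + 4^-1 * dot (y - x) (y - x).
Proof.
move=> ug; pose z := 2^-1 *: (x + y).
have zx : z - x = 2^-1 *: (y - x) by apply/rowP => i; rewrite !mxE; field.
have zy : z - y = - (2^-1 *: (y - x)) by apply/rowP => i; rewrite !mxE; field.
have := quad_tangent_le x z ug; have := quad_tangent_ge y z ug.
rewrite zx zy; move: (y - x) => v; rewrite !dotE; lra.
Qed.

(** Two-sided Taylor bounds control the slopes with the sharp constant: compare
    the tangents at [x] and [y] at the points [m + a] and [m - a], where [m] is
    the midpoint and [a] is half of the difference of the slopes. *)
Lemma quad_tangent_lipschitz u g x y : quad_tangent u g ->
  dot (g y - g x) (g y - g x) <= dot (y - x) (y - x).
Proof.
move=> ug; pose m := 2^-1 *: (x + y); pose a := 2^-1 *: (g y - g x).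
pose v := 2^-1 *: (y - x).
have yx : y - x = 2 *: v by rewrite scalerA mulfV ?pnatr_eq0// scale1r.
have gyx : g y - g x = 2 *: a by rewrite scalerA mulfV ?pnatr_eq0// scale1r.
have e1 : m + a - x = v + a by apply/rowP => i; rewrite !mxE; field.
have e2 : m + a - y = - v + a by apply/rowP => i; rewrite !mxE; field.
have e3 : m - a - x = v - a by apply/rowP => i; rewrite !mxE; field.
have e4 : m - a - y = - v - a by apply/rowP => i; rewrite !mxE; field.
have := quad_tangent_le x (m + a) ug; have := quad_tangent_ge y (m + a) ug.
have := quad_tangent_le y (m - a) ug; have := quad_tangent_ge x (m - a) ug.
have gyE : g y = g x + 2 *: a by rewrite -gyx addrC subrK.
rewrite e1 e2 e3 e4 gyx yx gyE; clearbody m a v.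
rewrite !dotE (dotC v a); lra.
Qed.

Lemma quad_tangent_dilation (l : R) u g : 0 < l -> quad_tangent u g ->
  quad_tangent (fun x => l ^- 2 * u (l *: x)) (fun x => l^-1 *: g (l *: x)).
Proof.
move=> l0 ug x y; have lN : l != 0 by rewrite gt_eqF.
have e : l *: y - l *: x = l *: (y - x) by rewrite scalerBr.
have := ug (l *: x) (l *: y); rewrite e; move: (y - x) => v.
rewrite dotZr !dotZl => h.
have -> : l ^- 2 * u (l *: y) - l ^- 2 * u (l *: x) - l^-1 * dot (g (l *: x)) v
  = l ^- 2 * (u (l *: y) - u (l *: x) - l * dot (g (l *: x)) v) by field.
have l2 : 0 < l ^- 2 by rewrite invr_gt0 exprn_gt0.
rewrite normrM (gtr0_norm l2) -(ler_pM2l (exprn_gt0 2 l0)) mulVKf//.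
  by apply: le_trans h _; rewrite dotZr; lra.
by rewrite expf_neq0.
Qed.

End quadratic_tangent.

(** * Interpolating finitely many data by a quadratically tangent function *)

Section global_minimum.
Context {R : realType} {n : nat}.

(** A continuous function attains its minimum as soon as some box contains
    competitors for all points; no coercivity is needed, which matters for
    functionals that are constant along some direction. *)
Lemma box_minimum (f : 'rV[R]_n -> R) (K : R) : continuous f ->
  (forall x, exists y : 'rV[R]_n, (forall i, `|y 0 i| <= K) /\ f y <= f x) ->
  exists m, forall x, f m <= f x.
Proof.
move=> cf bf; pose A := [set v : 'rV[R]_n | forall i, `[- K, K]%classic (v ord0 i)].
have cA : compact A by apply: (@rV_compact _ _ (fun=> `[- K, K]%classic)) => _; exact: segment_compact.
have inA (y : 'rV[R]_n) : (forall i, `|y 0 i| <= K) -> A y.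
  by move=> yK i; rewrite /= in_itv/= -ler_norml.
have A0 : A !=set0 by have [y [/inA Ay _]] := bf 0; exists y.
have [m _ mmin] := compact_EVT_min A0 cA (continuous_subspaceT cf).
exists m => x; have [y [/inA Ay yx]] := bf x; apply: le_trans yx.
by apply: mmin; rewrite inE.
Qed.

End global_minimum.

Section interpolation.
Context {R : realType} {d : nat} {J : finType}.
Variables (j0 : J) (a : J -> R) (b : J -> 'rV[R]_d).
Implicit Types x z : 'rV[R]_d.

Let h x := \big[Order.max/a j0 + dot (b j0) x]_j (a j + dot (b j) x).

Let h_ge j x : a j + dot (b j) x <= h x.
Proof. by rewrite /h; exact: le_bigmax. Qed.

Let h_le x t : (forall j, a j + dot (b j) x <= t) -> h x <= t.
Proof. by move=> ht; rewrite /h; apply/bigmax_leP; split=> [|j _]; exact: ht. Qed.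

Let continuous_h : continuous h.
Proof.
have aff j : continuous (fun x => a j + dot (b j) x).
  apply: ctsD; first exact: cts_cst.
  exact: continuous_dotr.
rewrite /h; elim: (index_enum J) => [|j s ih].
  by under eq_fun do rewrite big_nil; exact: aff.
by under eq_fun do rewrite big_cons; exact: cts_max.
Qed.

Let h_convex t x y : 0 <= t <= 1 ->
  h ((1 - t) *: x + t *: y) <= (1 - t) * h x + t * h y.
Proof.
move=> /andP[t0 t1]; apply: h_le => j; rewrite !dotE.
have := h_ge j x; have := h_ge j y.
have : 0 <= 1 - t by rewrite subr_ge0.
move: t0 (h x) (h y) (dot (b j) x) (dot (b j) y) => t0 hx hy bx by_ t1' hy' hx'.
by have := ler_wpM2l t1' hx'; have := ler_wpM2l t0 hy'; lra.
Qed.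

Let F z x := h x + 4^-1 * dot x x - dot x z.

Let F_min z : exists m, forall x, F z m <= F z x.
Proof.
pose w := b j0 - z.
have lbF x : a j0 - 2 * dot w w + 8^-1 * dot x x <= F z x.
  have := h_ge j0 x; have := @dot_young _ _ 8^-1 x (- w).
  rewrite invr_gt0 ltr0n => /(_ isT); rewrite /F /w !dotE (dotC z) (dotC x (b j0)).
  by rewrite (_ : (4 * 8^-1)^-1 = 2 :> R); [lra|field].
pose K := 8 * (F z 0 - a j0 + 2 * dot w w) + 1.
have K1 : 1 <= K.
  by rewrite lerDr mulr_ge0//; have := lbF 0; rewrite dot0l mulr0 addr0; lra.
apply: (@box_minimum _ _ _ K) => [|x].
  apply: ctsB; [apply: ctsD; first exact: continuous_h; apply: ctsM|].
  - exact: cts_cst.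
  - exact: continuous_sqnorm.
  - exact: continuous_dotl.
have [Fx|Fx] := leP (F z x) (F z 0); last first.
  by exists 0; split=> [i|]; [rewrite mxE normr0; lra|exact: ltW].
exists x; split=> // i; have xi := coord_sqr_le_dot x i.
have xK : x 0 i ^+ 2 <= K.
  by apply: le_trans xi _; have := lbF x; rewrite /K; lra.
rewrite -ler_sqr ?nnegrE//; last by lra.
rewrite real_normK ?num_real//; apply: le_trans xK _; nra.
Qed.

(** First-order optimality, in the form of the subgradient inequality: convexity
    of [h] lets the minimality of [m] be tested along segments. *)
Let F_subgradient z m x : (forall x, F z m <= F z x) ->
  h m + dot (z - 2^-1 *: m) (x - m) <= h x.
Proof.
move=> mmin; apply/ler_addgt0Pr => e e0.
have [v ->] : exists v, x = m + v by exists (x - m); rewrite addrC subrK.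
have K0 := dot_ge0 v; set K := dot v v in K0; rewrite (addrC m) addrK.
pose t := Num.min 1 (e / (K + 1)).
have K1 : 0 < K + 1 by rewrite ltr_wpDl.
have t0 : 0 < t by rewrite lt_min ltr01 divr_gt0.
have t1 : t <= 1 by rewrite ge_min lexx.
have tK : t * K <= e.
  have : t <= e / (K + 1) by rewrite ge_min lexx orbT.
  rewrite ler_pdivlMr// mulrDr mulr1; lra.
have := mmin ((1 - t) *: m + t *: (v + m)); have /h_convex := (introT andP (conj (ltW t0) t1)).
move=> /(_ m (v + m)).
have -> : (1 - t) *: m + t *: (v + m) = m + t *: v.
  by apply/rowP => i; rewrite !mxE; ring.
rewrite /F !dotE (dotC v m) (dotC z v) => hv Fv.
have : t * (h m + (dot v z - 2^-1 * dot m v) - 4^-1 * t * K) <= t * h (v + m).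
  by move: hv Fv; rewrite /K (dotC v z); lra.
by rewrite ler_pM2l//; lra.
Qed.

(** The witness is the Moreau envelope of [h - |.|^2/4], with slope [z - p z]
    where [p z] is the proximal point.  The upper tangent bound tests the envelope
    at the old proximal point; the lower one comes from the strong convexity of
    [F z], whose modulus is [1/4].  The same strong convexity, and the value of
    the kernel at the proximal point, give the two gains in the squared slope. *)
Lemma moreau_envelope_max_affine : exists u g,
  [/\ quad_tangent u g,
      forall x t, (forall j, a j + dot (b j) x - 4^-1 * dot x x <= t) ->
        u x + 4^-1 * dot (g x) (g x) <= t &
      forall x t, (forall y, exists j,
          t - 4^-1 * dot (y - x) (y - x) <= a j + dot (b j) y - 4^-1 * dot y y) ->
        t + 4^-1 * dot (g x) (g x) <= u x].
Proof.
have /choice[p pmin] : forall z, exists m, forall x, F z m <= F z x := F_min.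
pose u z := F z (p z) + 2^-1 * dot z z.
pose g z := z - p z.
have strong z x : F z (p z) + 4^-1 * dot (x - p z) (x - p z) <= F z x.
  have := F_subgradient x (pmin z); rewrite /F !dotE.
  by rewrite (dotC z x) (dotC z (p z)) (dotC x (p z)); lra.
exists u, g; split.
- move=> x y; rewrite ler_norml; apply/andP; split; last first.
    have := pmin y (p x); rewrite /u /F /g !dotE ?(dotC y x) ?(dotC y (p x)).
    by rewrite ?(dotC x (p x)); lra.
  have := strong x (p y); have := dot_ge0 (p y - p x - 2 *: (y - x)).
  rewrite /u /F /g !dotE ?(dotC y x) ?(dotC y (p x)) ?(dotC y (p y)).
  rewrite ?(dotC x (p x)) ?(dotC x (p y)) ?(dotC (p y) (p x)); lra.
- move=> x t ht; have := strong x x; have : h x <= t + 4^-1 * dot x x.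
    by apply: h_le => j; have := ht j; lra.
  rewrite /u /F /g !dotE; lra.
- move=> x t /(_ (p x))[j]; have := h_ge j (p x).
  rewrite /u /F /g !dotE ?(dotC x (p x)); lra.
Qed.

End interpolation.

(** The interpolant lies above the data and below their transform for the cost
    [|x - y|^2/4], with a margin on both sides that vanishes only at critical
    points; the margin is what excludes equality in the theorem. *)
Lemma quad_tangent_interpolation (R : realType) (d : nat) (J : finType)
    (y : J -> 'rV[R]_d) (psi : J -> R) : J -> exists u g,
  [/\ quad_tangent u g,
      forall j, psi j + 4^-1 * dot (g (y j)) (g (y j)) <= u (y j) &
      forall x t, (forall j, psi j - 4^-1 * dot (x - y j) (x - y j) <= t) ->
        u x + 4^-1 * dot (g x) (g x) <= t].
Proof.
move=> j0.
have [u [g [ug ule uge]]] := moreau_envelope_max_affine j0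
  (fun j => psi j - 4^-1 * dot (y j) (y j)) (fun j => 2^-1 *: y j).
have E j x : psi j - 4^-1 * dot (x - y j) (x - y j) =
    psi j - 4^-1 * dot (y j) (y j) + dot (2^-1 *: y j) x - 4^-1 * dot x x.
  by rewrite !dotE (dotC x (y j)); field.
exists u, g; split=> // [j|x t ht].
  by apply: uge => x; exists j; rewrite -E.
by apply: ule => j; rewrite -E.
Qed.

(** * Approximate duality for finite transport problems *)

Lemma box_minimum_fun (R : realType) (K : finType) (f : (K -> R) -> R) (B : R) :
  continuous (fun v : 'rV[R]_#|K| => f (fun k => v 0 (enum_rank k))) ->
  (forall s, exists s', (forall k, `|s' k| <= B) /\ f s' <= f s) ->
  exists m, forall s, f m <= f s.
Proof.
move=> cf bf.
have fE s : f s = f (fun k => (\row_i s (enum_val i)) 0 (enum_rank k)).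
  by congr f; apply/funext => k; rewrite mxE enum_rankK.
have [x|m mmin] := box_minimum cf (K := B).
  have [s' [s'B s'x]] := bf (fun k => x 0 (enum_rank k)).
  exists (\row_i s' (enum_val i)); rewrite -fE; split=> // i.
  by rewrite mxE.
by exists (fun k => m 0 (enum_rank k)) => s; rewrite (fE s); exact: mmin.
Qed.

(** Fermat's rule for a functional that loses at most a quadratic term. *)
Lemma quadratic_domination_eq0 (R : realType) (a b : R) : 0 <= b ->
  (forall t, t * a <= t ^+ 2 * b) -> a = 0.
Proof.
move=> b0 ab; apply/eqP; rewrite -sqrf_eq0 eq_le sqr_ge0 andbT.
have b1 : 0 < b + 1 by rewrite ltr_wpDl.
have := ab (a / (b + 1)); rewrite expr_div_n.
have -> : a / (b + 1) * a = (a ^+ 2 * (b + 1)) / (b + 1) ^+ 2.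
  by field; rewrite gt_eqF.
rewrite [leRHS]mulrAC ler_pM2r ?invr_gt0 ?exprn_gt0//; lra.
Qed.

Section transport_duality.
Context {R : realType} {I J : finType}.
Variables (i0 : I) (j0 : J) (p : I -> R) (q : J -> R) (c : I -> J -> R) (eps : R).
Hypotheses (p_gt0 : forall i, 0 < p i) (q_gt0 : forall j, 0 < q j).
Hypotheses (p_sum : \sum_i p i = 1) (q_sum : \sum_j q j = 1).
Hypotheses (c_ge0 : forall i j, 0 <= c i j) (eps_gt0 : 0 < eps).

Let pos (t : R) := Order.max 0 t.

Let pos_ge0 t : 0 <= pos t. Proof. by rewrite le_max lexx. Qed.

Let pos_ge t : t <= pos t. Proof. by rewrite le_max lexx orbT. Qed.

Let posM t : pos t * t = pos t ^+ 2.
Proof. by rewrite /pos; case: ltP => _; rewrite ?mul0r ?expr0n// expr2. Qed.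

Let pos_shift a t : pos (a + t) ^+ 2 <= pos a ^+ 2 + 2 * t * pos a + t ^+ 2.
Proof.
rewrite /pos; case: (ltP 0 (a + t)) => at0; case: (ltP 0 a) => a0.
- by rewrite le_eqVlt; apply/orP; left; apply/eqP; ring.
- by rewrite expr0n mulr0 !add0r; nra.
- by rewrite expr0n/=; have := sqr_ge0 (a + t); rewrite sqrrD; lra.
- by rewrite expr0n mulr0 !add0r sqr_ge0.
Qed.

Let term i j s := p i * q j * s - (2 * eps)^-1 * pos (s - c i j) ^+ 2.

Let D (s : I + J -> R) := \sum_i \sum_j term i j (s (inl i) + s (inr j)).

Let B := \sum_i \sum_j c i j + eps.

Let c_le i j : c i j <= \sum_i \sum_j c i j.
Proof.
rewrite (bigD1 i)//= (bigD1 j)//= -addrA lerDl addr_ge0//.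
  by apply: sumr_ge0 => ? _.
by apply: sumr_ge0 => ? _; exact: sumr_ge0.
Qed.

Let B_gt0 : 0 < B.
Proof. by rewrite ltr_wpDl//; apply: sumr_ge0 => ? _; exact: sumr_ge0. Qed.

Let p_le1 i : p i <= 1.
Proof.
by rewrite -p_sum (bigD1 i)//= lerDl; apply: sumr_ge0 => k _; exact: ltW.
Qed.

Let q_le1 j : q j <= 1.
Proof.
by rewrite -q_sum (bigD1 j)//= lerDl; apply: sumr_ge0 => k _; exact: ltW.
Qed.

Let pq_le1 i j : p i * q j <= 1.
Proof. by rewrite mulr_ile1// ltW. Qed.

Let pq_gt0 i j : 0 < p i * q j. Proof. exact: mulr_gt0. Qed.

(** The linear gain [p i * q j * s] is at most [c + P], where [P] is the positive
    part of [s - c], and the penalty beats [P] up to [eps]. *)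
Let term_le i j s : term i j s <= B.
Proof.
have := pos_ge (s - c i j); have := pos_ge0 (s - c i j); set P := pos _ => P0 sP.
have a0 := pq_gt0 i j; have a1 := pq_le1 i j.
have cB : c i j <= B - eps by rewrite addrK c_le.
have : p i * q j * s <= p i * q j * (c i j + P) by rewrite ler_pM2l//; lra.
have : p i * q j * (c i j + P) <= c i j + P.
  by rewrite ler_piMl// addr_ge0.
have : P - (2 * eps)^-1 * P ^+ 2 <= eps.
  have e2 : 0 <= (2 * eps)^-1 by rewrite invr_ge0 mulr_ge0 ?ltW.
  have := mulr_ge0 e2 (addr_ge0 (sqr_ge0 (P - eps)) (sqr_ge0 eps)).
  have -> : (2 * eps)^-1 * ((P - eps) ^+ 2 + eps ^+ 2)
     = (2 * eps)^-1 * P ^+ 2 - P + eps by field; rewrite gt_eqF.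
  lra.
rewrite /term -/P; lra.
Qed.

Let N : R := (#|I| * #|J|)%:R.

Let term_ge s : 0 <= D s -> forall i j, - (N * B) <= term i j (s (inl i) + s (inr j)).
Proof.
move=> Ds i j; pose t i j := term i j (s (inl i) + s (inr j)).
have : \sum_i \sum_j (B - t i j) = N * B - D s.
  under eq_bigr do rewrite sumrB sumr_const.
  by rewrite sumrB sumr_const -mulrnA mulnC -mulr_natl.
rewrite (bigD1 i)//= (bigD1 j)//= => e.
have : 0 <= \sum_(k | k != j) (B - t i k).
  by apply: sumr_ge0 => k _; rewrite subr_ge0; exact: term_le.
have : 0 <= \sum_(l | l != i) \sum_k (B - t l k).
  apply: sumr_ge0 => l _; apply: sumr_ge0 => k _; rewrite subr_ge0; exact: term_le.
have := B_gt0; rewrite -/(t i j); lra.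
Qed.

(** Every term is bounded above, so a nonnegative total bounds every term below;
    the linear part then bounds [s] from below and the penalty from above. *)
Let D_bounded : exists S, forall s, 0 <= D s ->
  forall i j, `|s (inl i) + s (inr j)| <= S.
Proof.
have B0 := B_gt0; have N0 : 0 <= N by rewrite ler0n.
pose L := \sum_i \sum_j N * B / (p i * q j).
have tL i j : N * B / (p i * q j) <= L.
  have h k l : 0 <= N * B / (p k * q l).
    exact: (divr_ge0 (mulr_ge0 N0 (ltW B0)) (ltW (pq_gt0 k l))).
  rewrite /L (bigD1 i)//= (bigD1 j)//= -addrA lerDl addr_ge0//.
    by apply: sumr_ge0 => ? _.
  by apply: sumr_ge0 => ? _; exact: sumr_ge0.
have L0 : 0 <= L.
  apply: le_trans (tL i0 j0).
  exact: (divr_ge0 (mulr_ge0 N0 (ltW B0)) (ltW (pq_gt0 i0 j0))).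
pose Q := 4 * eps ^+ 2 + 4 * eps * ((N + 1) * B).
have e0 := ltW eps_gt0.
have NB0 : 0 <= (N + 1) * B by rewrite mulr_ge0 ?(ltW B0)// addr_ge0.
have Q0 : 0 <= Q.
  by apply: addr_ge0; apply: mulr_ge0 => //; [exact: sqr_ge0|exact: mulr_ge0].
exists (L + B + Q + 1) => s /term_ge h i j; have {h} := h i j.
set r := s _ + s _; rewrite /term.
have := pos_ge (r - c i j); have := pos_ge0 (r - c i j); set P := pos _ => P0 rP t_ge.
have a0 := pq_gt0 i j; have a1 := pq_le1 i j.
have eP : 0 <= (2 * eps)^-1 * P ^+ 2 by rewrite mulr_ge0 ?sqr_ge0// invr_ge0 mulr_ge0 ?ltW.
have cB : c i j <= B - eps by rewrite addrK c_le.
have r_ge : - L <= r.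
  rewrite lerNl; apply: le_trans (tL i j); rewrite ler_pdivlMr//; lra.
have PQ : P ^+ 2 <= Q.
  have h1 : p i * q j * r <= B + P.
    have : p i * q j * r <= p i * q j * (c i j + P) by rewrite ler_pM2l//; lra.
    have : p i * q j * (c i j + P) <= c i j + P by rewrite ler_piMl// addr_ge0.
    by move: eps_gt0; lra.
  have : (2 * eps)^-1 * P ^+ 2 <= P + (N + 1) * B by lra.
  rewrite mulrC ler_pdivrMr ?mulr_gt0//.
  have := sqr_ge0 (P - 2 * eps); rewrite sqrrB /Q; nra.
have PQ1 : P <= Q + 1 by nra.
rewrite ler_norml; apply/andP; split; lra.
Qed.

(** The regularised dual functional is invariant under moving a constant from
    one potential to the other; normalising it away bounds the potentials. *)
Let D_max : exists m, forall s, D s <= D m.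
Proof.
have [S hS] := D_bounded.
have D0 : D (fun=> 0) = 0.
  rewrite /D big1// => i _; rewrite big1// => j _.
  have p0 : pos (0 + 0 - c i j) = 0 by rewrite /pos addr0 sub0r max_l// oppr_le0.
  by rewrite /term p0 addr0 expr0n/= !mulr0 subr0.
have [|s|m mmin] := @box_minimum_fun R _ (fun s => - D s) (3 * `|S|).
- under eq_fun do rewrite /D.
  have c0 k : continuous (fun v : 'rV[R]_#|{: I + J}| => v 0 (enum_rank k)).
    by move=> v; exact: coord_continuous.
  move=> v; apply: continuousN; move: v.
  apply: cts_sum => i; apply: cts_sum => j; rewrite /term.
  have cs : continuous (fun v : 'rV[R]_#|{: I + J}| =>
      v 0 (enum_rank (inl i)) + v 0 (enum_rank (inr j))) by exact: ctsD.
  apply: ctsB; apply: ctsM; rewrite ?expr2//; do ?exact: cts_cst.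
  rewrite /pos; under eq_fun do rewrite expr2.
  by apply: ctsM; apply: cts_max; do ?[exact: cts_cst|apply: ctsB].
- have [Ds|Ds] := ltP (D s) 0.
    exists (fun=> 0); rewrite D0; split=> [k|]; last by lra.
    by rewrite normr0 mulr_ge0.
  exists (fun k => match k with
    | inl i => s (inl i) + s (inr j0)
    | inr j => s (inr j) - s (inr j0) end); split=> [k|]; last first.
    rewrite lerN2 le_eqVlt; apply/orP; left; apply/eqP.
    apply: eq_bigr => i _; apply: eq_bigr => j _; congr term; lra.
  have h i j := le_trans (hS s Ds i j) (ler_norm S).
  case: k => [i|j]; first by have := h i j0; have := normr_ge0 S; lra.
  have -> : s (inr j) - s (inr j0)
    = (s (inl i0) + s (inr j)) - (s (inl i0) + s (inr j0)) by lra.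
  apply: le_trans (ler_normB _ _) _.
  by have := h i0 j; have := h i0 j0; have := normr_ge0 S; lra.
- by exists m => s; rewrite -lerN2.
Qed.

(** Maximise [sum phi p + sum psi q - (sum (phi + psi - c)_+^2) / (2 eps)]: the
    slopes of the penalty at the maximum form an exact transport plan, which is
    nearly complementary to the potentials. *)
Lemma transport_duality : exists (gam : I -> J -> R) (phi : I -> R) (psi : J -> R),
  [/\ forall i j, 0 <= gam i j,
      forall i, \sum_j gam i j = p i, forall j, \sum_i gam i j = q j,
      forall i j, phi i + psi j <= c i j &
      \sum_i \sum_j gam i j * c i j
        <= \sum_i p i * phi i + \sum_j q j * psi j + eps].
Proof.
have [m mmax] := D_max; have eN : eps != 0 by rewrite gt_eqF.
pose s i j := m (inl i) + m (inr j); pose gam i j := eps^-1 * pos (s i j - c i j).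
have gam0 i j : 0 <= gam i j by rewrite mulr_ge0// invr_ge0 ltW.
have incr i j t : p i * q j * t - gam i j * t - (2 * eps)^-1 * t ^+ 2
    <= term i j (s i j + t) - term i j (s i j).
  have := pos_shift (s i j - c i j) t; rewrite (addrAC (s i j)) => h.
  have : (2 * eps)^-1 * pos (s i j + t - c i j) ^+ 2 <= (2 * eps)^-1 *
    (pos (s i j - c i j) ^+ 2 + 2 * t * pos (s i j - c i j) + t ^+ 2).
    by rewrite ler_pM2l// invr_gt0 mulr_gt0.
  have -> : (2 * eps)^-1 * (pos (s i j - c i j) ^+ 2 + 2 * t * pos (s i j - c i j)
    + t ^+ 2) = (2 * eps)^-1 * pos (s i j - c i j) ^+ 2
    + eps^-1 * pos (s i j - c i j) * t + (2 * eps)^-1 * t ^+ 2 by field.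
  rewrite /term /gam; lra.
have e2 : 0 <= (2 * eps)^-1 by rewrite invr_ge0 mulr_ge0 ?ltW.
have sumB (K : finType) (f f' : K -> R) :
  \sum_k f k - \sum_k f' k = \sum_k (f k - f' k) by rewrite sumrB.
have rowp i : \sum_j gam i j = p i.
  apply/esym/eqP; rewrite -subr_eq0; apply/eqP.
  apply: (@quadratic_domination_eq0 _ _ (#|J|%:R * (2 * eps)^-1)) => [|t].
    by rewrite mulr_ge0.
  pose m' k := if k == inl i then m k + t else m k.
  have := mmax m'; rewrite /D -subr_le0 sumB (bigD1 i)//= [X in _ + X <= _]big1 ?addr0; last first.
    move=> k ki; rewrite sumB big1// => j _; rewrite /m'.
    by rewrite (inj_eq inl_inj) (negbTE ki)/= subrr.
  rewrite sumB [X in X <= 0](eq_bigr (fun j =>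
    term i j (s i j + t) - term i j (s i j))); last first.
    by move=> j _; rewrite /m' eqxx/= (addrAC (m (inl i))).
  move=> h; have {h} := le_trans (ler_sum _ (fun j _ => incr i j t)) h.
  rewrite !sumrB sumr_const -!mulr_suml -mulr_sumr q_sum mulr1 -mulr_natl; lra.
have colq j : \sum_i gam i j = q j.
  apply/esym/eqP; rewrite -subr_eq0; apply/eqP.
  apply: (@quadratic_domination_eq0 _ _ (#|I|%:R * (2 * eps)^-1)) => [|t].
    by rewrite mulr_ge0.
  pose m' k := if k == inr j then m k + t else m k.
  have := mmax m'; rewrite /D -subr_le0 sumB.
  rewrite [X in X <= 0](eq_bigr (fun i =>
    term i j (s i j + t) - term i j (s i j))); last first.
    move=> i _; rewrite sumB (bigD1 j)//= [X in _ + X]big1 ?addr0; last first.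
      move=> k kj; rewrite /m'.
      by rewrite (inj_eq inr_inj) (negbTE kj)/= subrr.
    by rewrite /m' eqxx/= addrA.
  move=> h; have {h} := le_trans (ler_sum _ (fun i _ => incr i j t)) h.
  rewrite !sumrB sumr_const -!mulr_suml p_sum mul1r -mulr_natl; lra.
exists gam, (fun i => m (inl i) - eps), (fun j => m (inr j)); split=> //.
- move=> i j; have : gam i j <= 1.
    apply: le_trans (p_le1 i); rewrite -rowp (bigD1 j)//= lerDl.
    exact: sumr_ge0.
  rewrite /gam mulrC ler_pdivrMr// mul1r.
  by have := pos_ge (s i j - c i j); rewrite /s; lra.
- have -> : \sum_i p i * (m (inl i) - eps) + \sum_j q j * m (inr j) + eps
      = \sum_i \sum_j gam i j * s i j.
    under [RHS]eq_bigr do under eq_bigr do rewrite mulrDr.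
    under [RHS]eq_bigr do rewrite big_split/= -mulr_suml rowp.
    rewrite big_split/= [in RHS]exchange_big/=.
    under [X in _ = _ + X]eq_bigr do rewrite -mulr_suml colq.
    under eq_bigr do rewrite mulrBr.
    by rewrite sumrB -mulr_suml p_sum; lra.
  apply: ler_sum => i _; apply: ler_sum => j _.
  have : 0 <= gam i j * (s i j - c i j).
    by rewrite /gam -mulrA posM mulr_ge0 ?sqr_ge0// invr_ge0 ltW.
  lra.
Qed.

End transport_duality.

(** * Quadratic tangency is C^{1,1} with gradient of Lipschitz constant at most 1 *)

Section c11.
Context {R : realType} {d : nat}.
Implicit Types (u : 'rV[R]_d -> R) (g : 'rV[R]_d -> 'rV[R]_d) (x y v w : 'rV[R]_d).

Let dot_is_linear w : linear (dot w : 'rV[R]_d -> R^o).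
Proof. by move=> k x y; rewrite !dotE. Qed.

HB.instance Definition _ w :=
  GRing.isLinear.Build R 'rV[R]_d R^o *:%R (dot w) (dot_is_linear w).

Lemma coord_le_norm x i : `|x 0 i| <= `|x|.
Proof.
have /mapP[j Hj ->] : `|x 0 i| \in [seq `|x k.1 k.2| | k : 'I_1 * 'I_d].
  by apply/mapP; exists (ord0, i) => //=; rewrite mem_enum.
by rewrite [leRHS]/Num.norm /= mx_normrE; apply/bigmax_geP; right => /=; exists j.
Qed.

Lemma sqnorm_le_norm x : dot x x <= d%:R * `|x| ^+ 2.
Proof.
have -> : d%:R * `|x| ^+ 2 = \sum_(i < d) `|x| ^+ 2.
  by rewrite sumr_const card_ord mulr_natl.
apply: ler_sum => i _; rewrite -expr2 -[leLHS]real_normK ?num_real//.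
by rewrite ler_sqr ?nnegrE// coord_le_norm.
Qed.

Lemma quad_tangent_expansion u g x : quad_tangent u g ->
  u \o shift x = cst (u x) + dot (g x) +o_ (0 : 'rV[R]_d) id.
Proof.
move=> ug; apply/eqaddoP => e e0.
have d0 : 0 < d%:R + 1 :> R by rewrite ltr_wpDl.
have e1 : 0 < e / (d%:R + 1) by rewrite divr_gt0.
have : \forall h \near (0 : 'rV[R]_d), `|h| <= e / (d%:R + 1) by exact: nbhs0_le.
apply: filterS => h he; rewrite /= !fctE/=.
have hxx : h + x - x = h by rewrite addrK.
have := ug x (h + x); rewrite hxx opprD addrA => /le_trans; apply.
apply: (@le_trans _ _ ((d%:R + 1) * `|h| ^+ 2)).
  have := sqnorm_le_norm h; have := dot_ge0 h; have := sqr_ge0 `|h|; lra.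
by rewrite expr2 mulrA ler_wpM2r// mulrC -ler_pdivlMr.
Qed.

Lemma quad_tangent_differentiable u g x : quad_tangent u g ->
  differentiable u x /\ 'd u x = dot (g x) :> ('rV[R]_d -> R).
Proof.
move=> ug; have e := quad_tangent_expansion x ug.
have cd : continuous (dot (g x) : 'rV[R]_d -> R^o) by exact: continuous_dotr.
have de := diff_unique cd e; split=> //.
by apply/diff_locallyP; rewrite de.
Qed.

Lemma quad_tangent_grad u g : quad_tangent u g -> grad u = g.
Proof.
move=> ug; apply/funext => x; apply/rowP => i; rewrite mxE.
have [du de] := quad_tangent_differentiable x ug.
by rewrite deriveE// de; exact: dot_delta.
Qed.

Lemma quad_tangent_lip u g : quad_tangent u g -> (lip g <= 1%:E)%E.
Proof.
move=> ug; apply: ereal_inf_lbound; exists 1 => //; split=> // x y.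
by rewrite mul1r enorm_le; exact: quad_tangent_lipschitz ug.
Qed.

Lemma continuous_of_lipschitz g :
  (forall x y, dot (g y - g x) (g y - g x) <= dot (y - x) (y - x)) -> continuous g.
Proof.
move=> gl x; apply/(@cvgrPdist_le _ _ _ _ (nbhs_filter x)) => e e0.
have d0 : 0 < d%:R + 1 :> R by rewrite ltr_wpDl.
near=> y.
have hle : (d%:R + 1) * `|y - x| <= e.
  rewrite mulrC -ler_pdivlMr// distrC; near: y.
  by apply: cvgr_dist_le; [exact: cvg_id|rewrite divr_gt0].
rewrite [leLHS]/Num.norm /= mx_normrE; apply/bigmax_leP; split=> [|[k i] _ /=].
  exact: ltW.
rewrite ord1; apply: le_trans hle.
rewrite -ler_sqr ?nnegrE ?mulr_ge0 ?addr_ge0// real_normK ?num_real//.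
apply: le_trans (coord_sqr_le_dot _ i) _.
have -> : dot (g x - g y) (g x - g y) = dot (g y - g x) (g y - g x).
  by rewrite -opprB !dotE; ring.
apply: le_trans (gl x y) _; apply: le_trans (sqnorm_le_norm _) _.
rewrite exprMn ler_wpM2r ?sqr_ge0//.
by rewrite -subr_ge0 sqrrD mulr1 expr1n; have := ler0n R d; nra.
Unshelve. all: by end_near. Qed.

Lemma quad_tangent_C11 u g : quad_tangent u g ->
  C11 u /\ (lip (grad u) <= 1%:E)%E.
Proof.
move=> ug; rewrite /C11 (quad_tangent_grad ug); have lg := quad_tangent_lip ug.
split=> //; split=> [x||]; last exact: le_lt_trans lg (ltry _).
  by have [] := quad_tangent_differentiable x ug.
by apply: continuous_of_lipschitz => x y; exact: quad_tangent_lipschitz.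
Qed.

Lemma lip_le1 g : (lip g <= 1%:E)%E ->
  forall x y, enorm (g x - g y) <= enorm (x - y).
Proof.
move=> g1 x y; apply/ler_addgt0Pr => e e0.
have E1 : 0 < enorm (x - y) + 1 by rewrite ltr_wpDl// enorm_ge0.
have : (lip g < (1 + e / (enorm (x - y) + 1))%:E)%E.
  by apply: le_lt_trans g1 _; rewrite lte_fin ltrDl divr_gt0.
move=> /ereal_inf_lt[_ [L [L0 Lg] <-]]; rewrite lte_fin => Le.
apply: le_trans (Lg x y) _; have E0 := enorm_ge0 (x - y).
apply: (@le_trans _ _ ((1 + e / (enorm (x - y) + 1)) * enorm (x - y))).
  by rewrite ler_wpM2r// ltW.
rewrite mulrDl mul1r lerD2l mulrAC ler_pdivrMr// ler_pM2l//; lra.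
Qed.

Lemma linear_row_sum (L : {linear 'rV[R]_d -> R}) v :
  L v = \sum_i L (delta_mx 0 i) * v 0 i.
Proof.
rewrite [in LHS](row_sum_delta v) linear_sum; apply: eq_bigr => i _.
by rewrite linearZ; exact: mulrC.
Qed.

Lemma derive_line u x v (t : R) : differentiable u (x + t *: v) ->
  is_derive t 1 (fun s : R => u (x + s *: v)) (dot (grad u (x + t *: v)) v).
Proof.
move=> du.
have E : (fun h : R => h^-1 *: (((fun s : R => u (x + s *: v)) \o shift t) (h *: 1)
    - u (x + t *: v))) = (fun h : R =>
    h^-1 *: ((u \o shift (x + t *: v)) (h *: v) - u (x + t *: v))).
  apply/funext => h /=; congr (_ *: (u _ - _)).
  by rewrite scalerDl /= addrCA; congr (_ *: _ + _); exact: mulr1.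
have dv := @diff_derivable _ _ _ _ _ v du.
have -> : dot (grad u (x + t *: v)) v = 'D_v u (x + t *: v).
  rewrite (deriveE _ du) [RHS]linear_row_sum /dot; apply: eq_bigr => i _.
  by congr (_ * _); rewrite mxE (deriveE _ du).
by split; rewrite /derivable /derive E.
Qed.

Lemma C11_tangent_le u g x y :
  (forall x v (t : R), is_derive t 1 (fun s : R => u (x + s *: v)) (dot (g (x + t *: v)) v)) ->
  (forall x y, enorm (g x - g y) <= enorm (x - y)) ->
  u y <= u x + dot (g x) (y - x) + 2^-1 * dot (y - x) (y - x).
Proof.
move=> du gl; have [v ->] : exists v, y = x + v by exists (y - x); rewrite addrC subrK.
rewrite [x + v]addrC addrK addrC.
pose a := dot (g x) v; pose b := dot v v.
pose f : R -> R := (fun s : R => u (x + s *: v)) - (a \*: id) - ((2^-1 * b) \*: id ^+ 2).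
have df (t : R) : is_derive t 1 f (dot (g (x + t *: v)) v - a - t * b).
  apply: is_derive_eq; rewrite /GRing.scale/= !mulr1 expr1; lra.
have cf : continuous f.
  by move=> t; apply/differentiable_continuous/derivable1_diffP; have [] := df t.
have [c c01] := MVT ltr01 (fun t _ => df t) (continuous_subspaceT cf).
rewrite subr0 mulr1 /f !fctE /= !scale0r !scale1r addr0.
have c0 : 0 < c by move: c01; rewrite in_itv/= => /andP[].
have : dot (g (x + c *: v) - g x) v <= c * b.
  apply: le_trans (dot_le_enorm _ _) _.
  apply: (@le_trans _ _ (enorm (c *: v) * enorm v)).
    by rewrite ler_wpM2r ?enorm_ge0//; have := gl (x + c *: v) x; rewrite (addrAC x) subrr add0r.
  have -> : enorm (c *: v) = c * enorm v.
    apply/eqP; rewrite -(@eqrXn2 _ 2) ?enorm_ge0 ?mulr_ge0 ?enorm_ge0 ?ltW//.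
    by rewrite exprMn !enorm_sqr !dotE; apply/eqP; ring.
  by rewrite -mulrA -expr2 enorm_sqr.
rewrite dotDl dotNl -/a /GRing.scale/=; lra.
Qed.

Lemma C11_quad_tangent u : C11 u -> (lip (grad u) <= 1%:E)%E -> quad_tangent u (grad u).
Proof.
move=> [du _ _] /lip_le1 gl x y.
have dl z v t := derive_line (du (z + t *: v)).
rewrite ler_norml; apply/andP; split; last first.
  have := C11_tangent_le x y dl gl; lra.
have dN z v (t : R) : is_derive t 1 (fun s : R => (- u) (z + s *: v))
    (dot (- grad u (z + t *: v)) v).
  by rewrite dotNl; exact: is_deriveN (dl z v t).
have gN z w : enorm (- grad u z - - grad u w) <= enorm (z - w).
  by rewrite -opprD enorm_le !dotNl !dotNr opprK -enorm_le.
have := @C11_tangent_le (- u) (fun z => - grad u z) x y dN gN.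
rewrite !fctE dotNl; lra.
Qed.

End c11.

(** * Measures with finite second moment *)

Section measurability.
Context {R : realType} {d : nat}.

Lemma open_measurable_borelRd (A : set 'rV[R]_d) :
  open A -> measurable (A : set (borelRd R d)).
Proof. exact: sub_sigma_algebra. Qed.

Lemma continuous_measurable_borelRd (u : 'rV[R]_d -> R) :
  continuous u -> measurable_fun [set: borelRd R d] u.
Proof.
move=> cu; apply: (measurability _ (RGenOpens.measurableE R)) => _ [_ [a [b ->]] <-].
rewrite setTI; apply: open_measurable_borelRd.
by apply: (open_comp (fun x _ => cu x)); exact: interval_open.
Qed.

Lemma measurable_coord i : measurable_fun [set: borelRd R d] (fun x : 'rV[R]_d => x 0 i).
Proof. by apply: continuous_measurable_borelRd => x; exact: coord_continuous. Qed.

Lemma measurable_dist_sqr : measurable_fun [set: borelRd R d * borelRd R d]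
  (fun z => dot ((z.1 : 'rV[R]_d) - z.2) ((z.1 : 'rV[R]_d) - z.2)).
Proof.
apply: measurable_sum => i.
have h : measurable_fun [set: borelRd R d * borelRd R d]
    (fun z => ((z.1 : 'rV[R]_d) - (z.2 : 'rV[R]_d)) 0 i).
  under eq_fun do rewrite !mxE.
  by apply: measurable_funB; apply: (measurableT_comp (measurable_coord i)).
exact: measurable_funM.
Qed.

End measurability.

Section finite_mixtures.
Context {R : realType} {disp : measure_display} {T : measurableType disp} {K : finType}.
Variables (w : K -> R) (P : K -> probability T R).
Hypothesis w_ge0 : forall k, 0 <= w k.
Local Open Scope ereal_scope.

Definition is_mixture (m : set T -> \bar R) :=
  forall A, measurable A -> m A = \sum_k (w k)%:E * P k A.

Let weighted k := mscale (NngNum (w_ge0 k)) (P k).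

Let mix (k0 : K) : {measure set T -> \bar R} :=
  msum (fun n => weighted (nth k0 (index_enum K) n)) (size (index_enum K)).

Let mixE k0 A : mix k0 A = \sum_k (w k)%:E * P k A.
Proof. by rewrite (big_nth k0) big_mkord. Qed.

(** The total mass is already one: normalising the weighted sum changes nothing
    but makes it a probability. *)
Lemma mixture_exists : (\sum_k w k = 1)%R -> exists m : probability T R, is_mixture m.
Proof.
move=> w1; have [k0 _] : exists k0 : K, true.
  case: (pickP (fun _ : K => true)) => [k0 _|h]; first by exists k0.
  by move: w1; rewrite big_pred0// => /eqP; rewrite eq_sym oner_eq0.
have m1 : mix k0 setT = 1.
  rewrite mixE -w1 -sumEFin; apply: eq_bigr => k _.
  by rewrite probability_setT mule1.
exists (mnormalize (mix k0) (P k0)) => A _.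
by rewrite /= /mnormalize m1 onee_eq0/= invr1 mule1 mixE.
Qed.

Lemma ge0_integral_mixture (m : {measure set T -> \bar R}) (f : T -> \bar R) :
  is_mixture m -> measurable_fun setT f -> (forall x, 0 <= f x) -> K ->
  \int[m]_x f x = \sum_k (w k)%:E * \int[P k]_x f x.
Proof.
move=> mm mf f0 k0.
rewrite (eq_measure_integral (mix k0)); last first.
  by move=> A mA _; rewrite mixE -mm.
rewrite ge0_integral_measure_sum// [RHS](big_nth k0) big_mkord.
by apply: eq_bigr => i _; rewrite ge0_integral_mscale.
Qed.

End finite_mixtures.

Section second_moment.
Context {R : realType} {d : nat}.
Implicit Types (P : probability (borelRd R d) R) (u f : 'rV[R]_d -> R).

Lemma P2E P : P2 P <-> (\int[P]_x (dot (x : 'rV[R]_d) x)%:E < +oo)%E.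
Proof. by rewrite /P2; under eq_integral do rewrite enorm_sqr. Qed.

(** Every function integrated below is measurable with at most quadratic growth,
    hence integrable for all measures with finite second moment; real-valued
    integrals are therefore linear on this class. *)
Definition quad_growth f := measurable_fun [set: borelRd R d] f /\
  exists C, forall x, `|f x| <= C * (1 + dot x x).

Lemma quad_growth_cst (c : R) : quad_growth (fun=> c).
Proof.
split; first exact: measurable_cst.
by exists `|c| => x; rewrite ler_peMr// lerDl dot_ge0.
Qed.

Lemma quad_growth_sqnorm : quad_growth (fun x => dot x x).
Proof.
split; first by apply: continuous_measurable_borelRd; exact: continuous_sqnorm.
by exists 1 => x; rewrite mul1r ger0_norm ?dot_ge0// lerDr.
Qed.

Lemma quad_growth_dot w : quad_growth (dot w).
Proof.
split; first by apply: continuous_measurable_borelRd; exact: continuous_dotr.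
exists (1 + dot w w) => x; rewrite ler_norml.
have := dot_young w x ltr01; have := dot_young w (- x) ltr01.
rewrite !dotE mulr1; have := dot_ge0 w; have := dot_ge0 x; nra.
Qed.

Lemma quad_growthD f u : quad_growth f -> quad_growth u ->
  quad_growth (fun x => f x + u x).
Proof.
move=> [mf [C fC]] [mu [D uD]]; split; first exact: measurable_funD.
by exists (C + D) => x; rewrite mulrDl (le_trans (ler_normD _ _))// lerD.
Qed.

Lemma quad_growthZ (c : R) f : quad_growth f -> quad_growth (fun x => c * f x).
Proof.
move=> [mf [C fC]]; split; first exact: measurable_funM.
by exists (`|c| * C) => x; rewrite normrM -mulrA ler_wpM2l.
Qed.

Lemma quad_growthB f u : quad_growth f -> quad_growth u ->
  quad_growth (fun x => f x - u x).
Proof.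
move=> qf /(quad_growthZ (-1)) /(quad_growthD qf).
by under eq_fun do rewrite mulN1r.
Qed.

Lemma quad_growth_dist (a : 'rV[R]_d) : quad_growth (fun x => dot (x - a) (x - a)).
Proof.
have -> : (fun x => dot (x - a) (x - a)) =
    (fun x => dot x x - 2 * dot a x + dot a a).
  by apply/funext => x; rewrite !dotE (dotC x a); ring.
apply: quad_growthD; last exact: quad_growth_cst.
apply: quad_growthB; first exact: quad_growth_sqnorm.
exact: quad_growthZ (quad_growth_dot a).
Qed.

Lemma quad_growth_tangent u g : quad_tangent u g -> quad_growth u.
Proof.
move=> ug; split.
  apply: continuous_measurable_borelRd => x; apply: differentiable_continuous.
  by have [] := quad_tangent_differentiable x ug.
have [_ [C gC]] := quad_growth_dot (g 0).
exists (`|u 0| + C + 1) => x; have := gC x; have := ug 0 x; rewrite !subr0.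
have := normr_ge0 (u 0); have := dot_ge0 x; have := ler_norm (u 0).
have := ler_norm (- u 0); rewrite normrN !ler_norml.
move: (dot x x) (dot (g 0) x) => q l ? ? q0 n0 /andP[? ?] /andP[? ?].
by apply/andP; split; nra.
Qed.

Lemma quad_growth_integrable P f : P2 P -> quad_growth f ->
  P.-integrable setT (EFin \o f).
Proof.
move=> /P2E P2P [mf [C fC]].
have i1 : P.-integrable setT (fun x => (1 + dot (x : 'rV[R]_d) x)%:E).
  under eq_fun do rewrite EFinD.
  apply: integrableD => //; first exact: finite_measure_integrable_cst.
  apply/integrableP; split; first by apply/measurable_EFinP; case: quad_growth_sqnorm.
  by under eq_integral do rewrite gee0_abs ?lee_fin ?dot_ge0//.
apply: (le_integrable _ _ _ (integrableZl _ C i1)) => //.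
  exact/measurable_EFinP.
move=> x _ /=; rewrite lee_fin; apply: le_trans (fC x) _; exact: ler_norm.
Qed.

Lemma Rintegral_EFin P f : P2 P -> quad_growth f ->
  (\int[P]_x (f x)%:E)%E = (\int[P]_x f x)%:E.
Proof.
move=> P2P qf; rewrite /Rintegral fineK//.
by apply: integrable_fin_num => //; exact: quad_growth_integrable.
Qed.

Lemma mean_cst P (c : R) : \int[P]_x c = c.
Proof.
rewrite Rintegral_cst// [X in fine X](_ : _ = 1%E) ?mulr1//.
exact: probability_setT.
Qed.

Lemma meanD P f u : P2 P -> quad_growth f -> quad_growth u ->
  \int[P]_x (f x + u x) = \int[P]_x f x + \int[P]_x u x.
Proof. by move=> ? ? ?; apply: RintegralD => //; exact: quad_growth_integrable. Qed.

Lemma meanB P f u : P2 P -> quad_growth f -> quad_growth u ->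
  \int[P]_x (f x - u x) = \int[P]_x f x - \int[P]_x u x.
Proof. by move=> ? ? ?; apply: RintegralB => //; exact: quad_growth_integrable. Qed.

Lemma meanZ P (c : R) f : P2 P -> quad_growth f ->
  \int[P]_x (c * f x) = c * \int[P]_x f x.
Proof. by move=> ? ?; apply: RintegralZl => //; exact: quad_growth_integrable. Qed.

Lemma mean_le P f u : P2 P -> quad_growth f -> quad_growth u ->
  (forall x, f x <= u x) -> \int[P]_x f x <= \int[P]_x u x.
Proof.
by move=> ? ? ? fu; apply: le_Rintegral => //; exact: quad_growth_integrable.
Qed.

Definition barycentre P : 'rV[R]_d := \row_i \int[P]_x (x : 'rV[R]_d) 0 i.

Definition dispersion P : R :=
  \int[P]_x dot ((x : 'rV[R]_d) - barycentre P) (x - barycentre P).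

Lemma dispersion_ge0 P : 0 <= dispersion P.
Proof. by apply: Rintegral_ge0 => x _; exact: dot_ge0. Qed.

Lemma mean_sum (I : Type) (s : seq I) P (F : I -> 'rV[R]_d -> R) : P2 P ->
  (forall i, quad_growth (F i)) ->
  \int[P]_x (\sum_(i <- s) F i x) = \sum_(i <- s) \int[P]_x F i x.
Proof.
move=> P2P qF; elim: s => [|i s ih].
  by under eq_Rintegral do rewrite big_nil; rewrite mean_cst big_nil.
have qs : quad_growth (fun x => \sum_(i <- s) F i x).
  elim: s {ih} => [|j s ih]; under eq_fun do rewrite ?big_nil ?big_cons.
    exact: quad_growth_cst.
  exact: quad_growthD.
by under eq_Rintegral do rewrite big_cons; rewrite meanD// ih big_cons.
Qed.

Lemma mean_dot P w : P2 P -> \int[P]_x dot w (x : 'rV[R]_d) = dot w (barycentre P).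
Proof.
move=> P2P; have qc i : quad_growth (fun x : 'rV[R]_d => x 0 i).
  by under eq_fun do rewrite -dot_delta dotC; exact: quad_growth_dot.
rewrite /dot mean_sum// => [|i]; last exact: quad_growthZ.
by apply: eq_bigr => i _; rewrite meanZ// mxE.
Qed.

Lemma mean_dot_centred P w : P2 P ->
  \int[P]_x dot w ((x : 'rV[R]_d) - barycentre P) = 0.
Proof.
move=> P2P; under eq_Rintegral do rewrite dotDr.
rewrite meanD ?mean_cst ?mean_dot//; last 2 first.
- exact: quad_growth_dot.
- exact: quad_growth_cst.
by rewrite dotNr subrr.
Qed.

Lemma quad_growth_dot_shift w (a : 'rV[R]_d) : quad_growth (fun x => dot w (x - a)).
Proof.
under eq_fun do rewrite dotDr.
by apply: quad_growthD; [exact: quad_growth_dot|exact: quad_growth_cst].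
Qed.

(** The parallel axis identity. *)
Lemma mean_dist_sqr P (a : 'rV[R]_d) : P2 P ->
  \int[P]_x dot ((x : 'rV[R]_d) - a) (x - a) =
  dot (barycentre P - a) (barycentre P - a) + dispersion P.
Proof.
move=> P2P; set b := barycentre P.
have E (x : 'rV[R]_d) : dot (x - a) (x - a) =
    (dot (b - a) (b - a) + 2 * dot (b - a) (x - b)) + dot (x - b) (x - b).
  by rewrite !dotE (dotC x a) (dotC x b) (dotC b a); ring.
under eq_Rintegral do rewrite E.
have ql := quad_growth_dot_shift (b - a) b.
have qc := quad_growth_cst (dot (b - a) (b - a)).
have q2 := quad_growthZ 2 ql.
rewrite meanD//; [|exact: quad_growthD|exact: quad_growth_dist].
by rewrite meanD// meanZ// mean_dot_centred// mean_cst mulr0 addr0.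
Qed.

(** The tangent at the barycentre integrates to its value there. *)
Lemma quad_tangent_mean_ge P u g : P2 P -> quad_tangent u g ->
  u (barycentre P) - 2^-1 * dispersion P <= \int[P]_x u x.
Proof.
move=> P2P ug; set b := barycentre P.
have ql := quad_growth_dot_shift (g b) b.
have qc := quad_growth_cst (u b); have qu := quad_growth_tangent ug.
have qv := quad_growthZ 2^-1 (quad_growth_dist b).
have -> : u b - 2^-1 * dispersion P = \int[P]_x
   (u b + dot (g b) ((x : 'rV[R]_d) - b) - 2^-1 * dot ((x : 'rV[R]_d) - b) (x - b)).
  rewrite meanB//; last exact: quad_growthD.
  by rewrite meanD// mean_cst mean_dot_centred// addr0 meanZ//; exact: quad_growth_dist.
apply: mean_le => // [|x]; last exact: quad_tangent_ge.
by apply: quad_growthB => //; exact: quad_growthD.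
Qed.

Lemma quad_tangent_mean_le P u g : P2 P -> quad_tangent u g ->
  \int[P]_x u x <= u (barycentre P) + 2^-1 * dispersion P.
Proof.
move=> P2P ug; set b := barycentre P.
have ql := quad_growth_dot_shift (g b) b.
have qc := quad_growth_cst (u b); have qu := quad_growth_tangent ug.
have qv := quad_growthZ 2^-1 (quad_growth_dist b).
have -> : u b + 2^-1 * dispersion P = \int[P]_x
   (u b + dot (g b) ((x : 'rV[R]_d) - b) + 2^-1 * dot ((x : 'rV[R]_d) - b) (x - b)).
  rewrite meanD//; last exact: quad_growthD.
  by rewrite meanD// mean_cst mean_dot_centred// addr0 meanZ//; exact: quad_growth_dist.
apply: mean_le => // [|x]; last exact: quad_tangent_le.
by apply: quad_growthD => //; exact: quad_growthD.
Qed.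

(** A function of quadratic growth is the difference of two nonnegative ones, one
    of which is a multiple of [1 + |x|^2]. *)
Lemma mean_mixture (K : finType) (w : K -> R) (Q : K -> probability (borelRd R d) R)
    P f : (forall k, 0 <= w k) -> is_mixture w Q P -> K -> P2 P ->
  (forall k, P2 (Q k)) -> quad_growth f ->
  \int[P]_x f x = \sum_k w k * \int[Q k]_x f x.
Proof.
move=> w0 mP k0 P2P P2Q [mf [C fC]].
have nonneg h : quad_growth h -> (forall x, 0 <= h x) ->
    \int[P]_x h x = \sum_k w k * \int[Q k]_x h x.
  move=> qh h0; apply: EFin_inj; rewrite -Rintegral_EFin//.
  rewrite (ge0_integral_mixture w0 mP)//; last first.
    by apply/measurable_EFinP; case: qh.
  by rewrite -sumEFin; apply: eq_bigr => k _; rewrite Rintegral_EFin.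
pose h (x : 'rV[R]_d) := C * (1 + dot x x).
have qf : quad_growth f by split=> //; exists C.
have qh : quad_growth h.
  apply: quad_growthZ; apply: quad_growthD; first exact: quad_growth_cst.
  exact: quad_growth_sqnorm.
have h0 x : 0 <= h x by apply: le_trans (fC x); exact: normr_ge0.
have fh0 x : 0 <= f x + h x.
  by have := fC x; rewrite ler_norml -/(h x) => /andP[]; lra.
have := nonneg _ (quad_growthD qf qh) fh0; rewrite meanD// (nonneg _ qh h0).
under [RHS]eq_bigr do rewrite meanD// mulrDr.
by rewrite big_split/= => /addIr.
Qed.

End second_moment.

(** * Gluing couplings of mixture components *)

Section gluing.
Context {R : realType} {d : nat}.
Implicit Types (mu nu P Q : probability (borelRd R d) R).

Lemma W2_sqrE mu nu :
  (W2 mu nu ^+ 2)%E = ereal_inf [set transport_cost gamma | gamma in couplings mu nu].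
Proof.
rewrite /W2 sqr_sqrte//; apply/ereal_infP => _ [gamma _ <-].
by apply: integral_ge0 => z _; rewrite lee_fin sqr_ge0.
Qed.

Lemma W2_sqr_ge0 mu nu : (0 <= W2 mu nu ^+ 2)%E.
Proof. exact: sqre_ge0. Qed.

Lemma transport_costE (gamma : probability (borelRd R d * borelRd R d)%type R) :
  transport_cost gamma =
  (\int[gamma]_z (dot ((z.1 : 'rV[R]_d) - z.2) ((z.1 : 'rV[R]_d) - z.2))%:E)%E.
Proof. by rewrite /transport_cost; under eq_integral do rewrite enorm_sqr. Qed.

(** Integrate the parallel axis identity first in one variable, then in the
    other. *)
Lemma product_cost P Q : P2 P -> P2 Q ->
  (\int[P \x Q]_z (dot ((z.1 : 'rV[R]_d) - z.2) ((z.1 : 'rV[R]_d) - z.2))%:E)%E =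
  (dot (barycentre P - barycentre Q) (barycentre P - barycentre Q)
    + dispersion P + dispersion Q)%:E.
Proof.
move=> P2P P2Q; rewrite fubini_tonelli1; last 2 first.
- by apply/measurable_EFinP; exact: measurable_dist_sqr.
- by move=> z; rewrite lee_fin dot_ge0.
rewrite /fubini_F /=.
have inner (x : 'rV[R]_d) : (\int[Q]_y (dot (x - (y : 'rV[R]_d)) (x - y))%:E)%E =
    (dot (x - barycentre Q) (x - barycentre Q) + dispersion Q)%:E.
  have flip (a b : 'rV[R]_d) : dot (a - b) (a - b) = dot (b - a) (b - a).
    by rewrite -opprB dotNl dotNr opprK.
  under eq_integral do rewrite flip.
  by rewrite (Rintegral_EFin P2Q (quad_growth_dist x)) mean_dist_sqr// flip.
under eq_integral do rewrite inner.
have qd := quad_growth_dist (barycentre Q); have qc : quad_growth (fun _ : 'rV[R]_d => dispersion Q) by exact: quad_growth_cst.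
rewrite (Rintegral_EFin P2P (quad_growthD qd qc)) (meanD P2P qd qc).
by rewrite mean_cst mean_dist_sqr.
Qed.

Variables (I J : finType) (p : I -> R) (q : J -> R) (gam : I -> J -> R).
Variables (P_ : I -> probability (borelRd R d) R) (Q_ : J -> probability (borelRd R d) R).
Hypotheses (i0 : I) (j0 : J) (gam_ge0 : forall i j, 0 <= gam i j).
Hypotheses (gam_row : forall i, \sum_j gam i j = p i).
Hypotheses (gam_col : forall j, \sum_i gam i j = q j).
Hypotheses (P2P : forall i, P2 (P_ i)) (P2Q : forall j, P2 (Q_ j)).

(** Inside each pair of pieces the coupling is independent, so a discrete plan
    [gam] between the barycentres costs the total dispersion more. *)
Lemma W2_sqr_le_gluing mu nu : \sum_i p i = 1 ->
  is_mixture p P_ mu -> is_mixture q Q_ nu ->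
  (W2 mu nu ^+ 2 <= (\sum_i \sum_j gam i j *
       dot (barycentre (P_ i) - barycentre (Q_ j)) (barycentre (P_ i) - barycentre (Q_ j))
     + \sum_i p i * dispersion (P_ i) + \sum_j q j * dispersion (Q_ j))%:E)%E.
Proof.
move=> p1 mu_mix nu_mix.
pose w (k : I * J) := gam k.1 k.2.
pose PQ (k : I * J) : probability (borelRd R d * borelRd R d)%type R :=
  (P_ k.1 \x Q_ k.2)%E.
have w0 k : 0 <= w k by exact: gam_ge0.
have w1 : \sum_k w k = 1.
  by rewrite -p1 -(eq_bigr _ (fun i _ => gam_row i)) pair_bigA.
have [gamma gammaE] := mixture_exists PQ w0 w1.
rewrite W2_sqrE; apply: (@le_trans _ _ (transport_cost gamma)).
  apply: ereal_inf_lbound; exists gamma => // A mA; split.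
  - have -> : pushforward gamma fst A = gamma (A `*` setT).
      by congr (gamma _); apply/seteqP; split=> z //= [].
    rewrite gammaE; last exact: measurableX.
    rewrite mu_mix// -(pair_bigA _ (fun i j => (gam i j)%:E * PQ (i, j) (A `*` setT)))%E/=.
    apply: eq_bigr => i _; rewrite -gam_row -sumEFin ge0_sume_distrl//; last first.
      by move=> j _; rewrite lee_fin.
    apply: eq_bigr => j _; congr (_ * _)%E.
    rewrite /PQ /= product_measure1E// -[RHS]mule1; congr (_ * _)%E.
    exact: probability_setT.
  - have -> : pushforward gamma snd A = gamma (setT `*` A).
      by congr (gamma _); apply/seteqP; split=> z //= [].
    rewrite gammaE; last exact: measurableX.
    rewrite nu_mix// -(pair_bigA _ (fun i j => (gam i j)%:E * PQ (i, j) (setT `*` A)))%E/=.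
    rewrite exchange_big/=.
    apply: eq_bigr => j _; rewrite -gam_col -sumEFin ge0_sume_distrl//; last first.
      by move=> i _; rewrite lee_fin.
    apply: eq_bigr => i _; congr (_ * _)%E.
    rewrite /PQ /= product_measure1E// -[RHS]mul1e; congr (_ * _)%E.
    exact: probability_setT.
rewrite transport_costE (ge0_integral_mixture w0 gammaE)//; last 2 first.
- by apply/measurable_EFinP; exact: measurable_dist_sqr.
- by move=> z; rewrite lee_fin dot_ge0.
under eq_bigr do rewrite product_cost// -EFinM.
rewrite sumEFin lee_fin le_eqVlt; apply/orP; left; apply/eqP.
rewrite -(pair_bigA _ (fun i j => gam i j * (dot (barycentre (P_ i) - barycentre (Q_ j))
  (barycentre (P_ i) - barycentre (Q_ j)) + dispersion (P_ i) + dispersion (Q_ j))))/=.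
under eq_bigr do under eq_bigr do rewrite !mulrDr.
under eq_bigr do rewrite !big_split/= -mulr_suml gam_row.
rewrite !big_split/=; congr (_ + _); rewrite exchange_big/=.
by apply: eq_bigr => j _; rewrite -mulr_suml gam_col.
Qed.

End gluing.

(** * Decomposition into components of small dispersion *)

Section cells.
Context {R : realType} {d : nat}.
Variables (P : probability (borelRd R d) R) (kap : 'rV[R]_d -> nat).
Hypothesis mkap : forall k : nat, measurable ([set x | kap x = k] : set (borelRd R d)).

Let cell k : set (borelRd R d) := [set x | kap x = k].

Let cond k : probability (borelRd R d) R := mnormalize (mrestr P (mkap k)) P.

Let condE k A : (0 < P (cell k))%E ->
  cond k A = (P (A `&` cell k) * (fine (P (cell k)))^-1%:E)%E.
Proof.
move=> Pk; rewrite /cond /= /mnormalize /= /mrestr setTI -/(cell k).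
by rewrite gt_eqF//= lt_eqF// (le_lt_trans (probability_le1 P (mkap k)))// ltry.
Qed.

(** Condition [P] on the cells of positive mass. *)
Lemma cell_mixture n : (forall x, (kap x < n)%N) ->
  exists (K : finType) (c : K -> 'I_n) (w : K -> R)
      (Q : K -> probability (borelRd R d) R),
  [/\ forall k, 0 < w k, is_mixture w Q P &
      forall k, Q k (~` [set x | kap x = c k]) = 0%E].
Proof.
move=> kn.
pose K : finType := {i : 'I_n | (0 < P (cell i))%E}.
pose w (k : K) := fine (P (cell (val k : 'I_n))).
have Pfin k : P (cell k) \is a fin_num by apply: fin_num_measure; exact: mkap.
have w_gt0 k : 0 < w k by rewrite fine_gt0// (valP k)/= ltey_eq Pfin.
exists K, val, w, (fun k : K => cond (val k : 'I_n)); split=> // [A mA|k]; last first.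
  by rewrite condE ?(valP k)// setICl measure0 mul0e.
have -> : P A = (\sum_(i < n) P (A `&` cell i))%E.
  have mAc i : measurable (A `&` cell i) by apply: measurableI => //; exact: mkap.
  have tAc : trivIset setT (fun i => A `&` cell i).
    by move=> i j _ _ [x [[_ <-] [_ <-]]].
  rewrite -(measure_bigsetU P mAc tAc).
  rewrite -(bigcup_mkord n (fun i => A `&` cell i)).
  congr (P _); apply/seteqP; split=> [x Ax|x [i _ []]//].
  by exists (kap x) => /=.
rewrite (bigID (fun i : 'I_n => (0 < P (cell i))%E))/= [X in (_ + X)%E]big1; last first.
  move=> i; rewrite -leNgt => Pi; apply/eqP; rewrite -measure_le0.
  apply: le_trans Pi; apply: le_measure; rewrite ?inE//; last exact: mkap.
  by apply: measurableI => //; exact: mkap.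
rewrite adde0 (big_sub [pred i : 'I_n | (0 < P (cell i))%E]
  (fun i : 'I_n => P (A `&` cell i))).
apply: eq_bigr => k _; rewrite condE; last exact: (valP k).
rewrite muleCA -EFinM divff ?mule1//; apply: lt0r_neq0; exact: w_gt0.
Qed.

End cells.

Section small_dispersion.
Context {R : realType} {d : nat}.
Implicit Types P : probability (borelRd R d) R.

Lemma mixture_P2 (K : finType) (w : K -> R) (Q : K -> probability (borelRd R d) R) P :
  (forall k, 0 < w k) -> is_mixture w Q P -> P2 P -> forall k, P2 (Q k).
Proof.
move=> w0 mP /P2E P2P k; apply/P2E.
have [msq _] := @quad_growth_sqnorm R d.
move: P2P; rewrite (ge0_integral_mixture (fun i => ltW (w0 i)) mP)//; last 2 first.
- exact/measurable_EFinP.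
- by move=> x; rewrite lee_fin dot_ge0.
rewrite (bigD1 k)//=; apply: contraTT; rewrite -!leNgt !leye_eq => /eqP ->.
rewrite gt0_muley ?lte_fin// addye// -ltNye; apply: (@lt_le_trans _ _ 0%E) => //.
apply: sume_ge0 => i _; apply: mule_ge0; first by rewrite lee_fin ltW.
by apply: integral_ge0 => x _; rewrite lee_fin dot_ge0.
Qed.

Variables (P : probability (borelRd R d) R) (kap : 'rV[R]_d -> nat) (a : nat -> 'rV[R]_d).
Hypothesis mkap : forall k : nat, measurable ([set x | kap x = k] : set (borelRd R d)).
Hypothesis P2P : P2 P.

Let F x := dot (x - a (kap x)) (x - a (kap x)).

(** The function is patched from countably many measurable ones. *)
Lemma measurable_cell_dist : measurable_fun [set: borelRd R d] F.
Proof.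
move=> _ B mB; rewrite setTI.
have -> : F @^-1` B = \bigcup_k ([set x | kap x = k] `&`
    (fun x => dot (x - a k) (x - a k)) @^-1` B).
  apply/seteqP; split=> [x Bx|x [k _ [/= <-]]//].
  by exists (kap x).
apply: bigcup_measurable => k _; apply: measurableI; first exact: mkap.
rewrite -[X in measurable X]setTI.
by have [mf _] := quad_growth_dist (a k); apply: mf.
Qed.

Lemma cell_mixture_dispersion (n : nat) (e : R) :
  (forall x, (kap x < n)%N) -> (\int[P]_x (F x)%:E <= e%:E)%E ->
  exists (K : finType) (w : K -> R) (Q : K -> probability (borelRd R d) R),
  [/\ forall k, 0 < w k, is_mixture w Q P, forall k, P2 (Q k) &
      \sum_k w k * dispersion (Q k) <= e].
Proof.
move=> kn Fe; have [K [c [w [Q [w0 mP Qc]]]]] := cell_mixture P mkap kn.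
have P2Q := mixture_P2 w0 mP P2P.
exists K, w, Q; split=> //.
have mF : measurable_fun [set: borelRd R d] (EFin \o F).
  by apply/measurable_EFinP; exact: measurable_cell_dist.
have F0 x : (0 <= (F x)%:E)%E by rewrite lee_fin dot_ge0.
have [k0|K0] := pickP (fun _ : K => true); last first.
  rewrite big_pred0//; rewrite -lee_fin; apply: le_trans Fe.
  exact: integral_ge0.
move=> _; rewrite -lee_fin; apply: le_trans Fe.
rewrite (ge0_integral_mixture (fun i => ltW (w0 i)) mP)//.
rewrite -sumEFin; apply: lee_sum => k _; rewrite EFinM.
apply: lee_wpmul2l; first by rewrite lee_fin ltW.
rewrite (@ae_eq_integral _ _ _ (Q k) setT
  (fun x => (dot (x - a (c k)) (x - a (c k)))%:E))//; last 2 first.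
- by apply/measurable_EFinP; case: (quad_growth_dist (a (c k))).
- exists (~` [set x | kap x = c k]); split; [|exact: Qc|].
    by apply: measurableC; exact: mkap.
  by move=> x /= h kx; apply: h => _; rewrite /F kx.
rewrite (Rintegral_EFin (P2Q k) (quad_growth_dist _)) mean_dist_sqr// lee_fin.
by rewrite lerDr dot_ge0.
Qed.

End small_dispersion.

Section grid.
Context {R : realType} {d : nat}.
Variable delta : R.
Hypothesis delta_gt0 : 0 < delta.

(** The grid point below [x], encoded as a natural number. *)
Let kap (x : 'rV[R]_d) : nat := pickle (\row_i Num.floor (x 0 i / delta) : 'rV[int]_d).

Let corner (k : nat) : 'rV[R]_d :=
  if unpickle k is Some v then \row_i (delta * ((v : 'rV[int]_d) 0 i)%:~R) else 0.

Let mkap (k : nat) : measurable ([set x | kap x = k] : set (borelRd R d)).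
Proof.
have [[v vk]|nv] := pselect (exists v : 'rV[int]_d, pickle v = k); last first.
  rewrite (_ : [set x | _] = set0); first exact: measurable0.
  by apply/seteqP; split=> // x /= h; apply: nv; eexists; exact: h.
have -> : [set x | kap x = k] = \bigcap_(i in [set: 'I_d])
    ((fun x : 'rV[R]_d => x 0 i) @^-1`
      `[delta * (v 0 i)%:~R, delta * (v 0 i + 1)%:~R[%classic).
  apply/seteqP; split=> [x /= xk i _|x /= xv].
    have <- : Num.floor (x 0 i / delta) = v 0 i.
      have : kap x = pickle v by rewrite xk vk.
      move=> /(pcan_inj pickleK) /rowP /(_ i); by rewrite mxE.
    have := Num.Theory.floor_itv (x 0 i / delta).
    by rewrite /= in_itv/= ler_pdivlMr// ltr_pdivrMr// ![_ * delta]mulrC.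
  rewrite -vk /kap; congr pickle; apply/rowP => i; rewrite mxE.
  apply: Num.Theory.floor_def; have := xv i I.
  by rewrite /= in_itv/= ler_pdivlMr// ltr_pdivrMr// ![_ * delta]mulrC.
apply: fin_bigcap_measurable => [|i _]; first exact: finite_finset.
by rewrite -[X in measurable X]setTI; apply: measurable_coord.
Qed.

Let corner_dist x : dot (x - corner (kap x)) (x - corner (kap x)) <= d%:R * delta ^+ 2.
Proof.
have -> : d%:R * delta ^+ 2 = \sum_(i < d) delta ^+ 2.
  by rewrite sumr_const card_ord mulr_natl.
apply: ler_sum => i _; rewrite /corner /kap pickleK !mxE -expr2.
have /andP[] := Num.Theory.floor_itv (x 0 i / delta).
rewrite ler_pdivlMr// ltr_pdivrMr// intrD => h1 h2.
by rewrite ler_sqr ?nnegrE; lra.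
Qed.

(** Only finitely many grid cells are kept; the others are merged into one cell,
    represented by the origin, whose second moment is a tail of that of [P]. *)
Lemma truncated_grid (P : probability (borelRd R d) R) (e : R) : P2 P -> 0 < e ->
  exists (n : nat) (kap' : 'rV[R]_d -> nat) (a : nat -> 'rV[R]_d),
  [/\ forall k : nat, measurable ([set x | kap' x = k] : set (borelRd R d)),
      forall x, (kap' x < n)%N &
      (\int[P]_x (dot ((x : 'rV[R]_d) - a (kap' x)) (x - a (kap' x)))%:E
        <= (d%:R * delta ^+ 2 + e)%:E)%E].
Proof.
move=> P2P e0; pose tail n : set (borelRd R d) := [set x | (n <= kap x)%N].
have mpre (B : set nat) : measurable ([set x | B (kap x)] : set (borelRd R d)).
  have -> : [set x | B (kap x)] = \bigcup_(k in B) [set x | kap x = k].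
    apply/seteqP; split=> [x Bx|x [k Bk /= xk]]; first by exists (kap x).
    by rewrite /= xk.
  by apply: bigcup_measurable => k _; exact: mkap.
have mtail n : measurable (tail n) by exact: (mpre [set k | (n <= k)%N]).
pose G n (x : 'rV[R]_d) : R := dot x x * \1_(tail n) x.
have [msq _] := @quad_growth_sqnorm R d.
have mG n : measurable_fun [set: borelRd R d] (EFin \o G n).
  by apply/measurable_EFinP; apply: measurable_funM => //; exact: measurable_indic.
have G_cvg : {ae P, forall x, setT x -> (EFin \o G n) x @[n --> \oo] --> 0%E}.
  apply: aeW => x _; apply: cvg_near_cst; exists (kap x).+1 => // n /= xn.
  by rewrite /G indicE (memNset _) ?mulr0// /tail /= leqNgt xn.
have G_le : {ae P, forall x n, setT x -> (`|(EFin \o G n) x| <= (dot x x)%:E)%E}.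
  apply: aeW => x n _; rewrite /= lee_fin /G normrM ger0_norm ?dot_ge0//.
  by rewrite ler_piMr ?dot_ge0// indicE normr_nat; case: (_ \in _).
have [_ _ G0] := dominated_convergence measurableT mG (measurable_cst 0%E) G_cvg
  (quad_growth_integrable P2P quad_growth_sqnorm) G_le.
rewrite integral0 in G0.
have [n Gn] : exists n, (\int[P]_x (G n x)%:E <= e%:E)%E.
  have /fine_cvgP[fG /cvgrPdist_le/(_ e e0) eG] := G0.
  have [n [fn en]] := filter_ex (filterI fG eG); exists n.
  rewrite -[X in (X <= _)%E](fineK fn) lee_fin; move: en; rewrite /= sub0r normrN.
  by apply: le_trans; exact: ler_norm.
pose kap' x := minn (kap x) n.
pose a k := if (k < n)%N then corner k else 0.
exists n.+1, kap', a; split=> [k|x|].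
- exact: (mpre [set m | minn m n = k]).
- by rewrite ltnS geq_minr.
have le1 x : dot (x - a (kap' x)) (x - a (kap' x)) <= d%:R * delta ^+ 2 + G n x.
  rewrite /a /kap' /G indicE; case: (ltnP (kap x) n) => xn.
    rewrite xn (memNset _) ?mulr0 ?addr0//.
    by rewrite /tail /= leqNgt xn.
  rewrite ltnn subr0 mem_set// mulr1 lerDr.
  by rewrite mulr_ge0// sqr_ge0.
apply: (@le_trans _ _ (\int[P]_x (d%:R * delta ^+ 2 + G n x)%:E)%E).
  apply: ge0_le_integral => //.
  - by move=> x _; rewrite lee_fin dot_ge0.
  - apply/measurable_EFinP; apply: measurable_cell_dist => k.
    exact: (mpre [set m | minn m n = k]).
  - by apply/measurable_EFinP; apply: measurable_funD => //; exact/measurable_EFinP.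
  - by move=> x _; rewrite lee_fin.
under eq_integral do rewrite EFinD.
have d0 : 0 <= d%:R * delta ^+ 2 by rewrite mulr_ge0// sqr_ge0.
have G_ge0 x : 0 <= G n x by rewrite mulr_ge0// dot_ge0.
rewrite ge0_integralD//; [|by move=> x _; rewrite lee_fin|exact: mG].
rewrite EFinD leeD// integral_cst//= [X in (_ * X)%E](_ : _ = 1%E) ?mule1//.
exact: probability_setT.
Qed.

End grid.

Lemma small_dispersion_mixture (R : realType) (d : nat)
    (P : probability (borelRd R d) R) (e : R) : P2 P -> 0 < e ->
  exists (K : finType) (w : K -> R) (Q : K -> probability (borelRd R d) R),
  [/\ forall k, 0 < w k, is_mixture w Q P, forall k, P2 (Q k) &
      \sum_k w k * dispersion (Q k) <= e].
Proof.
move=> P2P e0.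
pose delta : R := Num.min 1 (e / (2 * (d%:R + 1))).
have d1 : 0 < 2 * (d%:R + 1) :> R by rewrite mulr_gt0// ltr_wpDl.
have delta0 : 0 < delta by rewrite lt_min ltr01 divr_gt0.
have deltae : d%:R * delta ^+ 2 <= e / 2.
  have : delta <= 1 by rewrite ge_min lexx.
  have : delta <= e / (2 * (d%:R + 1)) by rewrite ge_min lexx orbT.
  by rewrite ler_pdivlMr//; have := ler0n R d; nra.
have [|n [kap [a [mkap kn]]]] := truncated_grid delta0 P2P (_ : 0 < e / 2).
  by rewrite divr_gt0.
move=> h; apply: (cell_mixture_dispersion mkap P2P kn (le_trans h _)).
by rewrite lee_fin; lra.
Qed.

(** * The dilation estimate *)

Section dilation_estimate.
Context {R : realType} {d : nat}.
Implicit Types (mu nu : probability (borelRd R d) R) (u : 'rV[R]_d -> R).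

Definition second_moment mu : R := \int[mu]_x dot (x : 'rV[R]_d) x.

Lemma mixture_barycentre_sqnorm (K : finType) (w : K -> R)
    (Q : K -> probability (borelRd R d) R) mu : K ->
  (forall k, 0 < w k) -> is_mixture w Q mu -> P2 mu -> (forall k, P2 (Q k)) ->
  \sum_k w k * dot (barycentre (Q k)) (barycentre (Q k)) <= second_moment mu.
Proof.
move=> k0 w0 mQ P2mu P2Q.
rewrite /second_moment (mean_mixture (fun k => ltW (w0 k)) mQ k0 P2mu P2Q); last first.
  exact: quad_growth_sqnorm.
apply: ler_sum => k _; rewrite ler_pM2l//.
have := mean_dist_sqr 0 (P2Q k); under eq_Rintegral do rewrite subr0.
by rewrite subr0 => ->; rewrite lerDl dispersion_ge0.
Qed.

Lemma mixture_weights_sum (K : finType) (w : K -> R)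
    (Q : K -> probability (borelRd R d) R) mu : is_mixture w Q mu -> \sum_k w k = 1.
Proof.
move=> /(_ setT measurableT) h; apply: EFin_inj.
transitivity (mu setT); last exact: probability_setT.
rewrite h -sumEFin; apply: eq_bigr => k _; rewrite -[LHS]mule1; congr (_ * _)%E.
by apply/esym; exact: probability_setT.
Qed.

(** Dilating [u] moves its values by the first-order term [(1 - l) <g x, x>],
    which Young's inequality charges to a quarter of the squared gradient and to
    the square of [1 - l]. *)
Lemma dilation_ge u g (l : R) x : quad_tangent u g ->
  u x - 4^-1 * dot (g x) (g x) - 3/2 * (1 - l) ^+ 2 * dot x x <= u (l *: x).
Proof.
move=> ug; have := quad_tangent_ge x (l *: x) ug.
have -> : l *: x - x = - ((1 - l) *: x) by rewrite scalerBl scale1r opprB.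
have := @dot_young _ _ 4^-1 (g x) ((1 - l) *: x).
rewrite invr_gt0 ltr0n => /(_ isT); rewrite mulfV ?pnatr_eq0// invr1 !dotE.
move: (u _) (u _) (dot _ _) (dot _ _) (dot _ _) => a b c e f; lra.
Qed.

Lemma dilation_le u g (l : R) x : quad_tangent u g ->
  u (l *: x) <= u x + 4^-1 * dot (g x) (g x) + 3/2 * (1 - l) ^+ 2 * dot x x.
Proof.
move=> ug; have := quad_tangent_le x (l *: x) ug.
have -> : l *: x - x = - ((1 - l) *: x) by rewrite scalerBl scale1r opprB.
have := @dot_young _ _ 4^-1 (g x) (- ((1 - l) *: x)).
rewrite invr_gt0 ltr0n => /(_ isT); rewrite mulfV ?pnatr_eq0// invr1 !dotE.
move: (u _) (u _) (dot _ _) (dot _ _) (dot _ _) => a b c e f; lra.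
Qed.

(** The margins of the interpolant at the atoms absorb the first-order cost of
    the dilation, so that only the square of [1 - l] remains. *)
Lemma dilated_test_function mu nu (l e : R) : P2 mu -> P2 nu ->
  0 < l -> l <= 1 -> 0 < e -> exists u g, quad_tangent u g /\
  ((4^-1)%:E * W2 mu nu ^+ 2 <= (l ^+ 2 * (\int[nu]_x u x - \int[mu]_x u x)
     + 3/2 * (1 - l) ^+ 2 * (second_moment mu + second_moment nu) + e)%:E)%E.
Proof.
move=> P2mu P2nu l0 l1 e0; have e4 : 0 < e / 4 by rewrite divr_gt0.
have [I [p [P [p0 mP P2P Pe]]]] := small_dispersion_mixture P2mu e4.
have [J [q [Q [q0 mQ P2Q Qe]]]] := small_dispersion_mixture P2nu e4.
have p1 := mixture_weights_sum mP; have q1 := mixture_weights_sum mQ.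
have inhabited_of (K : finType) (w : K -> R) : \sum_k w k = 1 -> K.
  case: (pickP (fun _ : K => true)) => [k _ _|h]; first exact: k.
  by rewrite big_pred0// => /eqP; rewrite eq_sym oner_eq0.
have i0 := inhabited_of _ _ p1; have j0 := inhabited_of _ _ q1.
pose x i := barycentre (P i); pose y j := barycentre (Q j).
pose c i j : R := 4^-1 * dot (x i - y j) (x i - y j).
have c0 i j : 0 <= c i j by rewrite mulr_ge0 ?dot_ge0.
have [gam [phi [psi [gam0 gamp gamq feas gap]]]] :=
  transport_duality i0 j0 p0 q0 p1 q1 c0 e4.
have [u [g [ug uy ux]]] := quad_tangent_interpolation y psi j0.
exists (fun z => l ^- 2 * u (l *: z)), (fun z => l^-1 *: g (l *: z)).
have vg := quad_tangent_dilation l0 ug; split=> //.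
have := W2_sqr_le_gluing i0 j0 gam0 gamp gamq P2P P2Q p1 mP mQ.
rewrite -(@lee_pmul2l _ (4^-1)%:E)// ?lte_fin ?invr_gt0//.
move=> /le_trans; apply; rewrite -EFinM lee_fin.
have -> : \sum_i \sum_j gam i j * dot (barycentre (P i) - barycentre (Q j))
    (barycentre (P i) - barycentre (Q j)) = 4 * \sum_i \sum_j gam i j * c i j.
  rewrite mulr_sumr; apply: eq_bigr => i _; rewrite mulr_sumr.
  by apply: eq_bigr => j _; rewrite /c [RHS]mulrCA mulVKf ?pnatr_eq0.
have l2 : l ^+ 2 <= 1 by rewrite expr_le1// ltW.
have l20 : 0 < l ^+ 2 by rewrite exprn_gt0.
have ylow j : psi j - 3/2 * (1 - l) ^+ 2 * dot (y j) (y j) <= u (l *: y j).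
  by have := dilation_ge l (y j) ug; have := uy j; lra.
have xupp i : u (l *: x i) <= - phi i + 3/2 * (1 - l) ^+ 2 * dot (x i) (x i).
  have := dilation_le l (x i) ug; have : u (x i) + 4^-1 * dot (g (x i)) (g (x i)) <= - phi i.
    by apply: ux => j; have := feas i j; rewrite /c; lra.
  lra.
have nu_ge : \sum_j q j * psi j - 3/2 * (1 - l) ^+ 2 * second_moment nu - 2^-1 * (e / 4)
    <= l ^+ 2 * \int[nu]_z (l ^- 2 * u (l *: z)).
  rewrite (mean_mixture (fun k => ltW (q0 k)) mQ j0 P2nu P2Q); last first.
    exact: quad_growth_tangent vg.
  have := mixture_barycentre_sqnorm j0 q0 mQ P2nu P2Q.
  have step j : q j * psi j - 3/2 * (1 - l) ^+ 2 * (q j * dot (y j) (y j))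
      - 2^-1 * (q j * dispersion (Q j))
      <= l ^+ 2 * (q j * \int[Q j]_z (l ^- 2 * u (l *: z))).
    have := quad_tangent_mean_ge (P2Q j) vg; rewrite -/(y j) => h.
    have {}h : u (l *: y j) - 2^-1 * dispersion (Q j)
        <= l ^+ 2 * \int[Q j]_z (l ^- 2 * u (l *: z)).
      have := ler_wpM2l (ltW l20) h; rewrite mulrBr mulVKf ?gt_eqF//.
      have := dispersion_ge0 (Q j); nra.
    have := ler_wpM2l (ltW (q0 j)) h; have := ler_wpM2l (ltW (q0 j)) (ylow j).
    rewrite !mulrBr; move: (q j) => qj; lra.
  have := ler_sum (index_enum J) (fun j (_ : true) => step j).
  rewrite !sumrB -!mulr_sumr => hs hm.
  have : 3/2 * (1 - l) ^+ 2 * \sum_j q j * dot (y j) (y j)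
    <= 3/2 * (1 - l) ^+ 2 * second_moment nu.
    by rewrite ler_wpM2l// mulr_ge0// sqr_ge0.
  lra.
have mu_le : l ^+ 2 * \int[mu]_z (l ^- 2 * u (l *: z)) <=
    - \sum_i p i * phi i + 3/2 * (1 - l) ^+ 2 * second_moment mu + 2^-1 * (e / 4).
  rewrite (mean_mixture (fun k => ltW (p0 k)) mP i0 P2mu P2P); last first.
    exact: quad_growth_tangent vg.
  have := mixture_barycentre_sqnorm i0 p0 mP P2mu P2P.
  have step i : l ^+ 2 * (p i * \int[P i]_z (l ^- 2 * u (l *: z))) <=
      3/2 * (1 - l) ^+ 2 * (p i * dot (x i) (x i)) + 2^-1 * (p i * dispersion (P i))
      - p i * phi i.
    have := quad_tangent_mean_le (P2P i) vg; rewrite -/(x i) => h.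
    have {}h : l ^+ 2 * \int[P i]_z (l ^- 2 * u (l *: z))
        <= u (l *: x i) + 2^-1 * dispersion (P i).
      have := ler_wpM2l (ltW l20) h; rewrite mulrDr mulVKf ?gt_eqF//.
      have := dispersion_ge0 (P i); nra.
    have := ler_wpM2l (ltW (p0 i)) h; have := ler_wpM2l (ltW (p0 i)) (xupp i).
    rewrite !mulrDr; move: (p i) => pi; lra.
  have := ler_sum (index_enum I) (fun i (_ : true) => step i).
  rewrite sumrB big_split/= -!mulr_sumr => hs hm.
  have : 3/2 * (1 - l) ^+ 2 * \sum_i p i * dot (x i) (x i)
    <= 3/2 * (1 - l) ^+ 2 * second_moment mu.
    by rewrite ler_wpM2l// mulr_ge0// sqr_ge0.
  lra.
rewrite [l ^+ 2 * (_ - _)]mulrBr; lra.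
Qed.

Lemma Z2_ge mu nu u g : P2 mu -> P2 nu -> quad_tangent u g ->
  ((\int[nu]_x u x - \int[mu]_x u x)%:E <= Z2 mu nu)%E.
Proof.
move=> P2mu P2nu ug; have qu := quad_growth_tangent ug.
apply: ereal_sup_ubound; exists u; first exact: quad_tangent_C11 ug.
by rewrite (Rintegral_EFin P2nu qu) (Rintegral_EFin P2mu qu) EFinB.
Qed.

Lemma W2_sqr_le_Z2 mu nu : P2 mu -> P2 nu ->
  ((4^-1)%:E * W2 mu nu ^+ 2 <= Z2 mu nu)%E.
Proof.
move=> P2mu P2nu; apply/lee_addgt0Pr => e e0.
have [u [g [ug h]]] := dilated_test_function P2mu P2nu ltr01 (lexx 1) e0.
apply: le_trans h _; rewrite expr1n mul1r subrr expr0n/= mulr0 mul0r addr0 EFinD.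
by apply: leeD => //; exact: Z2_ge ug.
Qed.

Lemma W2_sqr_fin_num mu nu : P2 mu -> P2 nu -> (W2 mu nu ^+ 2)%E \is a fin_num.
Proof.
move=> P2mu P2nu; rewrite ge0_fin_numE ?W2_sqr_ge0//.
have [u [g [ug]]] := dilated_test_function P2mu P2nu ltr01 (lexx 1) ltr01.
have := W2_sqr_ge0 mu nu; case: (W2 mu nu ^+ 2)%E => //= [r _ _|_]; first exact: ltry.
by rewrite gt0_muley ?lte_fin ?invr_gt0.
Qed.

(** In the case of equality the dilation estimate reads [W <= 6 t M] for every
    dilation factor [1 - t]. *)
Lemma W2_sqr_eq0_of_eq mu nu : P2 mu -> P2 nu ->
  ((4^-1)%:E * W2 mu nu ^+ 2 = Z2 mu nu)%E -> (W2 mu nu ^+ 2 = 0)%E.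
Proof.
move=> P2mu P2nu WZ; have := W2_sqr_fin_num P2mu P2nu; have := W2_sqr_ge0 mu nu.
move eW : (W2 mu nu ^+ 2)%E => W W0 Wfin; move: W0 WZ eW.
rewrite -(fineK Wfin) lee_fin; move: (fine W) => w w0 WZ eW.
congr (_%:E); apply/eqP; rewrite eq_le w0 andbT.
set M := second_moment mu + second_moment nu.
have M0 : 0 <= M.
  by rewrite addr_ge0//; apply: Rintegral_ge0 => x _; exact: dot_ge0.
have key t : 0 < t -> t < 1 -> w <= 6 * t * M.
  move=> t0 t1; have : 4^-1 * w * (1 - (1 - t) ^+ 2) <= 3/2 * t ^+ 2 * M.
    apply/ler_addgt0Pr => e e0.
    have [||u [g [ug]]] := dilated_test_function P2mu P2nu (_ : 0 < 1 - t) (_ : 1 - t <= 1) e0.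
    - lra.
    - lra.
    have := Z2_ge P2mu P2nu ug; rewrite -WZ eW -!EFinM !lee_fin -/M.
    move=> /(ler_wpM2l (sqr_ge0 (1 - t))); rewrite subKr; lra.
  have -> : 4^-1 * w * (1 - (1 - t) ^+ 2) = t * (4^-1 * w * (2 - t)) by ring.
  have -> : 3/2 * t ^+ 2 * M = t * (3/2 * t * M) by ring.
  rewrite ler_pM2l//; nra.
apply/ler_addgt0Pr => e e0; rewrite add0r.
pose t := Num.min (2^-1) (e / (6 * M + 1)).
have M1 : 0 < 6 * M + 1 by rewrite ltr_wpDl// mulr_ge0.
have t0 : 0 < t by rewrite lt_min invr_gt0 ltr0n divr_gt0.
have t1 : t < 1 by rewrite gt_min invf_lt1 ?ltr1n.
have te : t * (6 * M + 1) <= e.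
  by rewrite -ler_pdivlMr// ge_min lexx orbT.
by apply: le_trans (key t t0 t1) _; nra.
Qed.

End dilation_estimate.

(** * Vanishing transport cost *)

Section vanishing_cost.
Context {R : realType} {d : nat}.
Implicit Types (mu nu : probability (borelRd R d) R) (F : set 'rV[R]_d) (r : R).

Local Notation RdRd := (borelRd R d * borelRd R d)%type.

Lemma norm_sqr_le_sqnorm (x : 'rV[R]_d) : `|x| ^+ 2 <= dot x x.
Proof.
have [->|] := eqVneq `|x| 0; first by rewrite expr0n dot_ge0.
move=> /mx_norm_neq0[[i j]]; rewrite ord1 => xj.
have -> : `|x| = `|x 0 j| by exact: xj.
by rewrite real_normK ?num_real// coord_sqr_le_dot.
Qed.

Definition enlargement F r : set 'rV[R]_d := \bigcup_(x in F) ball x r.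

Lemma open_enlargement F r : open (enlargement F r).
Proof. by apply: bigcup_open => x _; exact: ball_open. Qed.

Lemma bigcap_enlargement F : closed F -> \bigcap_n enlargement F n.+1%:R^-1 = F.
Proof.
move=> cF; apply/seteqP; split=> [y yF|y Fy n _]; last first.
  by exists y => //; apply: ballxx; rewrite invr_gt0.
apply: cF => B /nbhs_ballP[e /= e0 eB].
have [n ne] : exists n : nat, n.+1%:R^-1 < e.
  have en := truncnS_gt e^-1; eexists; rewrite invf_plt ?posrE//; exact: en.
have [x Fx xy] := yF n I; exists x; split=> //; apply: eB.
by apply: (le_ball (ltW ne)); exact: ball_sym.
Qed.

(** Markov's inequality: mass leaving the [r]-enlargement travels at least [r].
    The maps [f] and [g] are the two projections, in either order. *)
Lemma enlargement_le (gamma : probability RdRd R) (f g : RdRd -> borelRd R d) F r :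
  measurable_fun setT f -> measurable_fun setT g ->
  (forall z, dot ((f z : 'rV[R]_d) - g z) ((f z : 'rV[R]_d) - g z) =
             dot ((z.1 : 'rV[R]_d) - z.2) ((z.1 : 'rV[R]_d) - z.2)) ->
  closed F -> 0 < r ->
  (gamma (f @^-1` F) <= gamma (g @^-1` enlargement F r)
     + (r ^- 2)%:E * transport_cost gamma)%E.
Proof.
move=> mf mg fg cF r0.
pose D (z : RdRd) := dot ((z.1 : 'rV[R]_d) - z.2) ((z.1 : 'rV[R]_d) - z.2).
have mD : measurable_fun setT D := measurable_dist_sqr.
pose B : set RdRd := [set z | r ^+ 2 <= D z].
have mB : measurable B.
  have -> : B = D @^-1` `[r ^+ 2, +oo[%classic.
    by apply/seteqP; split=> z /=; rewrite in_itv/= andbT.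
  by rewrite -[X in measurable X]setTI; apply: mD => //; exact: measurable_itv.
have mF : measurable (f @^-1` F).
  rewrite -[X in measurable X]setTI; apply: mf => //.
  rewrite -(setCK F); apply: measurableC; apply: open_measurable_borelRd.
  exact: closed_openC.
have mE : measurable (g @^-1` enlargement F r).
  rewrite -[X in measurable X]setTI; apply: mg => //.
  by apply: open_measurable_borelRd; exact: open_enlargement.
have markov : (gamma B <= (r ^- 2)%:E * transport_cost gamma)%E.
  rewrite transport_costE -(@lee_pmul2l _ (r ^+ 2)%:E)// ?lte_fin ?exprn_gt0//.
  rewrite muleA -EFinM mulfV ?mul1e ?expf_neq0 ?gt_eqF//.
  rewrite -integral_cst//; apply: (@le_trans _ _ (\int[gamma]_(z in B) (D z)%:E)%E).
    apply: ge0_le_integral => //.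
    - by move=> z _; rewrite lee_fin sqr_ge0.
    - by apply/measurable_EFinP; exact: measurable_funTS.
  apply: ge0_subset_integral => //; first exact/measurable_EFinP.
  by move=> z _; rewrite lee_fin dot_ge0.
apply: le_trans (leeD (lexx _) markov).
apply: le_trans (measureU2 _ mE mB); apply: le_measure; rewrite ?inE//.
  exact: measurableU.
move=> z Fz; have [zB|zB] := leP (r ^+ 2) (D z); first by right.
left; exists (f z) => //; rewrite -ball_normE /=.
rewrite -ltr_sqr ?nnegrE ?(ltW r0)//; apply: le_lt_trans zB.
by rewrite /D -fg norm_sqr_le_sqnorm.
Qed.


(** Up to the cost divided by the squared radius, each enlargement of [F] has at
    least the [m]-mass of [F], and the enlargements decrease to [F]. *)
Lemma closed_le_of_small_cost (m n : probability (borelRd R d) R)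
    (f g : RdRd -> borelRd R d) F :
  measurable_fun setT f -> measurable_fun setT g ->
  (forall z, dot ((f z : 'rV[R]_d) - g z) ((f z : 'rV[R]_d) - g z) =
             dot ((z.1 : 'rV[R]_d) - z.2) ((z.1 : 'rV[R]_d) - z.2)) ->
  (forall e : R, 0 < e -> exists gamma : probability RdRd R,
    [/\ forall A, measurable A -> gamma (f @^-1` A) = m A,
        forall A, measurable A -> gamma (g @^-1` A) = n A &
        (transport_cost gamma < e%:E)%E]) ->
  closed F -> (m F <= n F)%E.
Proof.
move=> mf mg fg small cF.
have mFr r : measurable (enlargement F r : set (borelRd R d)).
  by apply: open_measurable_borelRd; exact: open_enlargement.
have mF : measurable (F : set (borelRd R d)).
  rewrite -(setCK F); apply: measurableC; apply: open_measurable_borelRd.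
  exact: closed_openC.
have le r : 0 < r -> (m F <= n (enlargement F r))%E.
  move=> r0; apply/lee_addgt0Pr => e e0.
  have [gamma [gf gg gc]] := small (r ^+ 2 * e) (mulr_gt0 (exprn_gt0 2 r0) e0).
  have := enlargement_le gamma mf mg fg cF r0; rewrite gf// gg//.
  move=> /le_trans; apply; apply: leeD => //.
  rewrite -[leRHS]mul1e -(@mulVf _ (r ^+ 2)) ?expf_neq0 ?gt_eqF// EFinM -muleA.
  by apply: lee_wpmul2l; [rewrite lee_fin invr_ge0 sqr_ge0|rewrite -EFinM ltW].
have cvg : n \o (fun k : nat => enlargement F k.+1%:R^-1) @ \oo
    --> n (\bigcap_k enlargement F k.+1%:R^-1).
  apply: nonincreasing_cvg_mu => //.
  - by apply: le_lt_trans (probability_le1 n (mFr _)) _; exact: ltry.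
  - by rewrite bigcap_enlargement.
  - move=> i j ij; apply/subsetPset => y [x Fx xy]; exists x => //.
    by apply: le_ball xy; rewrite lef_pV2 ?posrE// ler_nat.
rewrite (bigcap_enlargement cF) in cvg; rewrite -(cvg_lim _ cvg)//.
apply: lime_ge; first by apply/cvg_ex; eexists; exact: cvg.
by apply: nearW => k /=; apply: le; rewrite invr_gt0.
Qed.

(** Closed sets have equal mass by symmetry, and open sets generate the Borel
    sets and are stable under intersection. *)
Lemma meas_eq_of_W2_sqr_eq0 mu nu : (W2 mu nu ^+ 2 = 0)%E -> meas_eq mu nu.
Proof.
rewrite W2_sqrE => W0.
have small (e : R) : 0 < e -> exists2 gamma, couplings mu nu gamma &
    (transport_cost gamma < e%:E)%E.
  move=> e0; have : (ereal_inf [set transport_cost gamma | gamma in couplings mu nu]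
    < e%:E)%E by rewrite W0 lte_fin.
  by move=> /ereal_inf_lt[_ [gamma cg <-] ge]; exists gamma.
have closed_eq F : closed F -> mu F = nu F.
  move=> cF; apply/eqP; rewrite eq_le; apply/andP; split.
  - apply: (@closed_le_of_small_cost mu nu fst snd) => //.
    + move=> e /small[gamma cg ge]; exists gamma.
      by split=> // A mA; have [] := cg A mA.
  - apply: (@closed_le_of_small_cost nu mu snd fst) => //.
    + by move=> z; rewrite -opprB dotNl dotNr opprK.
    + move=> e /small[gamma cg ge]; exists gamma.
      by split=> // A mA; have [] := cg A mA.
have open_eq (U : set (borelRd R d)) : open (U : set 'rV[R]_d) -> mu U = nu U.
  move=> oU; have mU : measurable U by exact: open_measurable_borelRd.
  have := closed_eq _ (open_closedC oU).
  rewrite !probability_setC//.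
  have := fin_num_measure mu _ mU; have := fin_num_measure nu _ mU.
  move: (mu U) (nu U) => [x| |] [y| |] //= _ _ [xy]; congr (_%:E); lra.
have openI_closed : setI_closed (@open 'rV[R]_d) by move=> U V oU oV; exact: openI.
have mu_fin (k : nat) : (mu setT < +oo)%E.
  exact: le_lt_trans (probability_le1 mu measurableT) (ltry _).
move=> A mA; exact: (@measure_unique _ R (borelRd R d) (@open 'rV[R]_d) (fun=> setT)
  erefl openI_closed (fun=> openT) (bigcup_const _ _) mu nu open_eq mu_fin A mA).
Qed.

Lemma Z2_le0_of_meas_eq mu nu : meas_eq mu nu -> (Z2 mu nu <= 0)%E.
Proof.
move=> e; apply/ereal_supP => _ [u _ <-].
have -> : (\int[nu]_x (u x)%:E = \int[mu]_x (u x)%:E)%E.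
  by apply: eq_measure_integral => A mA _; apply/esym; exact: e.
by case: (\int[mu]_x _)%E => [r| |]; rewrite -?EFinB ?subrr ?leNye.
Qed.

End vanishing_cost.

(** * Optimality of the constant *)

Section separated_supports.
Context {R : realType} {d : nat}.
Variables (mu nu : probability (borelRd R d) R) (E O : set (borelRd R d)).
Hypotheses (mE : measurable E) (mO : measurable O) (muE : mu E = 1%E) (nuO : nu O = 1%E).
Hypothesis apart : forall x y, E x -> O y -> 1 <= dot ((x : 'rV[R]_d) - y) (x - y).

(** Almost every pair is at distance at least one, whatever the coupling. *)
Lemma W2_sqr_ge1 : (1 <= W2 mu nu ^+ 2)%E.
Proof.
rewrite W2_sqrE; apply/ereal_infP => _ [gamma cg <-]; rewrite transport_costE.
pose G : set (borelRd R d * borelRd R d) := fst @^-1` E `&` snd @^-1` O.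
have mfE : measurable (fst @^-1` E : set (borelRd R d * borelRd R d)).
  by rewrite -[X in measurable X]setTI; exact: measurable_fst.
have mfO : measurable (snd @^-1` O : set (borelRd R d * borelRd R d)).
  by rewrite -[X in measurable X]setTI; exact: measurable_snd.
have mG : measurable G by exact: measurableI.
have G1 : gamma G = 1%E.
  have -> : G = ~` (~` (fst @^-1` E) `|` ~` (snd @^-1` O)) by rewrite setCU !setCK.
  have gE : gamma (fst @^-1` E) = 1%E by rewrite -muE; have [] := cg _ mE.
  have gO : gamma (snd @^-1` O) = 1%E by rewrite -nuO; have [] := cg _ mO.
  have gE0 : gamma (~` (fst @^-1` E)) = 0%E by rewrite probability_setC// gE subee.
  have gO0 : gamma (~` (snd @^-1` O)) = 0%E by rewrite probability_setC// gO subee.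
  have mU := measurableU _ _ (measurableC mfE) (measurableC mfO).
  rewrite probability_setC// [X in (1 - X)%E](_ : _ = 0%E) ?sube0//.
  apply/eqP; rewrite -measure_le0.
  have := measureU2 gamma (measurableC mfE) (measurableC mfO).
  by move=> /le_trans; apply; rewrite [X in (X + _)%E]gE0 [X in (_ + X)%E]gO0 adde0.
rewrite -{1}G1 -[gamma G]mul1e -integral_cst//.
have mD := @measurable_dist_sqr R d.
apply: (@le_trans _ _ (\int[gamma]_(z in G)
    (dot ((z.1 : 'rV[R]_d) - z.2) ((z.1 : 'rV[R]_d) - z.2))%:E)%E).
  apply: ge0_le_integral => //.
  - by apply/measurable_EFinP; exact: measurable_funTS.
  - by move=> z [Ez Oz]; rewrite lee_fin; exact: apart.
apply: ge0_subset_integral => //; first exact/measurable_EFinP.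
by move=> z _; rewrite lee_fin dot_ge0.
Qed.

End separated_supports.

Section dirac_mixtures.
Context {R : realType} {d : nat}.
Implicit Types f : 'rV[R]_d -> R.

Let dirac_at (x : 'rV[R]_d) : probability (borelRd R d) R := \d_(x : borelRd R d).

Lemma P2_dirac x : P2 (dirac_at x).
Proof.
apply/P2E; have [msq _] := @quad_growth_sqnorm R d.
by rewrite integral_dirac//; [rewrite diracT mul1e ltry|exact/measurable_EFinP].
Qed.

Lemma mean_dirac x f : quad_growth f -> \int[dirac_at x]_y f y = f x.
Proof.
move=> [mf _]; rewrite /Rintegral integral_dirac//; last exact/measurable_EFinP.
by rewrite diracT mul1e.
Qed.

Lemma dirac_mixture (K : finType) (w : K -> R) (x : K -> 'rV[R]_d) : K ->
  (forall k, 0 <= w k) -> \sum_k w k = 1 ->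
  exists mu : probability (borelRd R d) R, [/\ P2 mu,
    forall f, quad_growth f -> \int[mu]_y f y = \sum_k w k * f (x k) &
    forall A : set (borelRd R d), measurable A -> (forall k, A (x k)) -> mu A = 1%E].
Proof.
move=> k0 w0 w1; have [mu muE] := mixture_exists (fun k => dirac_at (x k)) w0 w1.
have P2mu : P2 mu.
  apply/P2E; have [msq _] := @quad_growth_sqnorm R d.
  rewrite (ge0_integral_mixture w0 muE)//; last 2 first.
  - exact/measurable_EFinP.
  - by move=> y; rewrite lee_fin dot_ge0.
  under eq_bigr do rewrite (Rintegral_EFin (P2_dirac _) quad_growth_sqnorm) -EFinM.
  by rewrite sumEFin ltry.
exists mu; split=> // [f qf|A mA Ax].
  rewrite (mean_mixture w0 muE k0 P2mu (fun k => P2_dirac (x k)) qf).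
  by apply: eq_bigr => k _; rewrite mean_dirac.
rewrite muE// -w1 -sumEFin; apply: eq_bigr => k _.
by rewrite /= diracE mem_set ?mule1.
Qed.

End dirac_mixtures.

Section alternating_sums.
Context {R : realType}.
Variable h : nat -> R.

Let f m := (-1) ^+ m * h m.

(** Since the sign changes with the index, the sum of neighbours is a difference
    of consecutive values of [f]. *)
Lemma alternating_telescope (a N : nat) :
  \sum_(b < N) (-1) ^+ (a + b) * (h (a + b) + h (a + b).+1) = f a - f (a + N)%N.
Proof.
elim: N => [|N ih]; first by rewrite big_ord0 addn0 subrr.
by rewrite big_ord_recr/= ih /f addnS exprS; ring.
Qed.

Hypothesis h1 : forall m, `|h m - h m.+1| <= 1.

Lemma alternating_bound (a K : nat) : `|\sum_(b < K.*2) f (a + b)| <= K%:R.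
Proof.
elim: K => [|K ih]; first by rewrite big_ord0 normr0.
rewrite doubleS !big_ord_recr/= -addrA.
have -> : f (a + K.*2) + f (a + K.*2.+1) =
    (-1) ^+ (a + K.*2) * (h (a + K.*2) - h (a + K.*2).+1).
  by rewrite /f addnS exprS; ring.
apply: le_trans (ler_normD _ _) _; rewrite -natr1 lerD//.
by rewrite normrM normrX normrN1 expr1n mul1r.
Qed.

(** The double sum telescopes in one index and cancels in pairs in the other, so
    it grows like the side of the square rather than its area. *)
Lemma alternating_double_sum (K : nat) :
  \sum_(a < K.*2) \sum_(b < K.*2) (-1) ^+ (a + b) * (h (a + b) + h (a + b).+1)
    <= K.*2%:R.
Proof.
under eq_bigr do rewrite alternating_telescope.
rewrite sumrB.
have b0 : `|\sum_(a < K.*2) f a| <= K%:R := alternating_bound 0 K.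
have bK : `|\sum_(a < K.*2) f (a + K.*2)| <= K%:R.
  by under eq_bigr do rewrite addnC; exact: alternating_bound.
move: b0 bK; rewrite !ler_norml => /andP[_ +] /andP[+ _].
by rewrite -addnn natrD; lra.
Qed.

End alternating_sums.

Section chain.
Context {R : realType} {d : nat}.
Let e : 'rV[R]_d.+1 := delta_mx 0 0.
Let pt (m : nat) : 'rV[R]_d.+1 := m%:R *: e.
Let even_of m := if odd m then m.+1 else m.
Let odd_of m := if odd m then m else m.+1.

Let dot_ee : dot e e = 1.
Proof. by rewrite dot_delta mxE !eqxx. Qed.

Let ptS m : pt m.+1 - pt m = e.
Proof. by rewrite -scalerBl -natr1 addrC addKr scale1r. Qed.

Let ptSN m : pt m - pt m.+1 = - e.
Proof. by rewrite -opprB ptS. Qed.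

Let dist_pt (i j : nat) : dot (pt i - pt j) (pt i - pt j) = (i%:R - j%:R) ^+ 2.
Proof. by rewrite -scalerBl dotZl dotZr dot_ee mulr1 expr2. Qed.

(** Along the edge from [m] to [m + 1] the orientation from even to odd has the
    sign [(-1)^m]. *)
Let edge u g m : quad_tangent u g -> u (pt (odd_of m)) - u (pt (even_of m)) <=
  4^-1 + 2^-1 * ((-1) ^+ m * (dot (g (pt m)) e + dot (g (pt m.+1)) e)).
Proof.
move=> ug; rewrite -signr_odd /odd_of /even_of; case: (odd m) => /=.
  have := quad_tangent_midpoint (pt m.+1) (pt m) ug.
  by rewrite ptSN !dotNr dotNl opprK dot_ee expr1; lra.
have := quad_tangent_midpoint (pt m) (pt m.+1) ug.
by rewrite ptS dot_ee expr0; lra.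
Qed.

Let slope u g m : quad_tangent u g ->
  `|dot (g (pt m)) e - dot (g (pt m.+1)) e| <= 1.
Proof.
move=> ug; rewrite -dotNl -dotDl -(@ler_pXn2r _ 2)// ?nnegrE// expr1n.
rewrite real_normK ?num_real//; apply: le_trans (dot_cauchy _ _) _.
rewrite dot_ee mulr1; apply: le_trans (quad_tangent_lipschitz (pt m.+1) (pt m) ug) _.
by rewrite ptSN dotNl dotNr opprK dot_ee.
Qed.

Let evens : set (borelRd R d.+1) := range (fun k : nat => pt k.*2).
Let odds : set (borelRd R d.+1) := range (fun k : nat => pt k.*2.+1).

Let measurable_range (f : nat -> 'rV[R]_d.+1) :
  measurable (range f : set (borelRd R d.+1)).
Proof.
apply: countable_measurable; last exact: card_image_le.
move=> x; rewrite -(setCK [set x]); apply: measurableC.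
apply: open_measurable_borelRd; apply: closed_openC.
exact: (accessible_closed_set1 (hausdorff_accessible (@norm_hausdorff _ _))).
Qed.

Let evens_odds_apart (x y : 'rV[R]_d.+1) : evens x -> odds y -> 1 <= dot (x - y) (x - y).
Proof.
move=> [i _ <-] [j _ <-]; rewrite dist_pt.
case: (leqP i j) => ij.
  have : (i.*2)%:R <= (j.*2)%:R :> R by rewrite ler_nat leq_double.
  by rewrite -(natr1 j.*2); nra.
have : (j.*2.+2)%:R <= (i.*2)%:R :> R by rewrite ler_nat -doubleS leq_double.
by rewrite -2!natr1; nra.
Qed.

(** Both measures are averages over the pairs [(a, b)] with [a, b < 2K] of an atom
    at one end of the edge from [a + b] to [a + b + 1], the even end for [mu] and
    the odd end for [nu]. *)
Lemma chain_measures (K : nat) : (0 < K)%N ->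
  exists mu nu : probability (borelRd R d.+1) R, [/\ P2 mu, P2 nu,
    (1 <= W2 mu nu ^+ 2)%E & (Z2 mu nu <= (4^-1 + (4 * K%:R)^-1)%:E)%E].
Proof.
move=> K0; pose N := K.*2.
have N0 : (0 < N)%N by rewrite double_gt0.
have NR : 0 < N%:R :> R by rewrite ltr0n.
pose k0 : 'I_N * 'I_N := (Ordinal N0, Ordinal N0).
pose w (k : 'I_N * 'I_N) : R := N%:R ^- 2.
have w0 k : 0 <= w k by rewrite invr_ge0 sqr_ge0.
have w1 : \sum_k w k = 1.
  rewrite sumr_const card_prod card_ord -[LHS]mulr_natr natrM /w -expr2 mulVf//.
  by rewrite expf_neq0// gt_eqF.
have [mu [P2mu muf muA]] :=
  dirac_mixture (fun k : 'I_N * 'I_N => pt (even_of (k.1 + k.2))) k0 w0 w1.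
have [nu [P2nu nuf nuA]] :=
  dirac_mixture (fun k : 'I_N * 'I_N => pt (odd_of (k.1 + k.2))) k0 w0 w1.
exists mu, nu; split=> //.
  apply: (@W2_sqr_ge1 R d.+1 mu nu evens odds) => //.
  - exact: measurable_range.
  - exact: measurable_range.
  - apply: muA => [|k]; first exact: measurable_range.
    by exists (uphalf (k.1 + k.2)) => //; rewrite uphalfK /even_of; case: odd.
  - apply: nuA => [|k]; first exact: measurable_range.
    exists (k.1 + k.2)./2 => //; rewrite halfK /odd_of.
    by case: ifP => [mo|_]; rewrite ?subn0// subn1 prednK// odd_gt0.
apply/ereal_supP => _ [u [uC ul] <-]; have ug := C11_quad_tangent uC ul.
have qu := quad_growth_tangent ug; set g := grad u in ug.
rewrite (Rintegral_EFin P2nu qu) (Rintegral_EFin P2mu qu) -EFinB lee_fin.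
rewrite nuf// muf//.
pose h m := dot (g (pt m)) e.
have hs := alternating_double_sum (fun m => slope m ug) K.
have -> : \sum_k w k * u (pt (odd_of (k.1 + k.2)))
    - \sum_k w k * u (pt (even_of (k.1 + k.2)))
  = N%:R ^- 2 * \sum_(a < N) \sum_(b < N)
      (u (pt (odd_of (a + b)%N)) - u (pt (even_of (a + b)%N))).
  rewrite pair_bigA/= mulr_sumr -sumrB.
  by apply: eq_bigr => k _; rewrite -mulrBr.
have : \sum_(a < N) \sum_(b < N) (u (pt (odd_of (a + b)%N)) - u (pt (even_of (a + b)%N)))
    <= N%:R ^+ 2 * 4^-1 + 2^-1 * N%:R.
  have step : \sum_(a < N) \sum_(b < N)
      (u (pt (odd_of (a + b)%N)) - u (pt (even_of (a + b)%N))) <=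
    \sum_(a < N) \sum_(b < N)
      (4^-1 + 2^-1 * ((-1) ^+ (a + b)%N * (h (a + b)%N + h (a + b)%N.+1))).
    by apply: ler_sum => a _; apply: ler_sum => b _; exact: edge.
  apply: le_trans step _.
  under eq_bigr do rewrite big_split/= sumr_const card_ord -mulr_sumr.
  rewrite big_split/= sumr_const card_ord -mulr_sumr -mulrnA.
  have -> : 4^-1 *+ (N * N) = N%:R ^+ 2 * 4^-1 :> R.
    by rewrite -[LHS]mulr_natl natrM expr2.
  by rewrite lerD2l ler_pM2l ?invr_gt0.
have N2 : 0 <= N%:R ^- 2 :> R by rewrite invr_ge0 sqr_ge0.
move=> /(ler_wpM2l N2) /le_trans; apply.
rewrite le_eqVlt; apply/orP; left; apply/eqP.
rewrite /N -mul2n natrM; field.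
by rewrite pnatr_eq0 -lt0n.
Qed.

End chain.

(** With [K + 1 > (4 (c - 1/4))^-1], the error term of the chain is below
    [c - 1/4]. *)
Lemma quarter_optimal (R : realType) (d : nat) (c : R) : (1 <= d)%N -> 4^-1 < c ->
  exists mu nu : probability (borelRd R d) R,
    [/\ P2 mu, P2 nu & (Z2 mu nu < c%:E * W2 mu nu ^+ 2)%E].
Proof.
case: d => // d _ c4; pose r := c - 4^-1.
have r0 : 0 < r by rewrite subr_gt0.
have [K rK] : exists K : nat, (4 * r)^-1 < K.+1%:R.
  by eexists; exact: truncnS_gt.
have [mu [nu [P2mu P2nu W Z]]] := @chain_measures R d K.+1 isT.
exists mu, nu; split=> //; apply: le_lt_trans Z _.
apply: (@lt_le_trans _ _ c%:E).
  have K0 : 0 < K.+1%:R :> R by rewrite ltr0n.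
  rewrite lte_fin -ltrBrDl -/r invf_plt ?posrE ?mulr_gt0//.
  have : r^-1 = 4 * (4 * r)^-1 by field; rewrite gt_eqF.
  by move=> ->; rewrite ltr_pM2l.
rewrite -[leLHS]mule1; apply: lee_wpmul2l => //.
by rewrite lee_fin ltW// (lt_trans _ c4)// invr_gt0.
Qed.

Theorem theorem3p1 (R : realType) (d : nat) (hd : (1 <= d)%N) :
  [/\ forall mu nu : probability (borelRd R d) R, P2 mu -> P2 nu ->
        ((4^-1)%:E * W2 mu nu ^+ 2 <= Z2 mu nu)%E,
      forall c : R, 4^-1 < c ->
        exists mu nu : probability (borelRd R d) R,
          [/\ P2 mu, P2 nu & (Z2 mu nu < c%:E * W2 mu nu ^+ 2)%E] &
      forall mu nu : probability (borelRd R d) R, P2 mu -> P2 nu ->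
        ((4^-1)%:E * W2 mu nu ^+ 2 = Z2 mu nu)%E <-> meas_eq mu nu].
Proof.
split=> [mu nu P2mu P2nu|c c4|mu nu P2mu P2nu].
- exact: W2_sqr_le_Z2.
- exact: quarter_optimal.
split=> [WZ|mn]; first exact: meas_eq_of_W2_sqr_eq0 (W2_sqr_eq0_of_eq P2mu P2nu WZ).
apply/eqP; rewrite eq_le W2_sqr_le_Z2//=; apply: le_trans (Z2_le0_of_meas_eq mn) _.
by apply: mule_ge0; [rewrite lee_fin invr_ge0|exact: W2_sqr_ge0].
Qed.
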